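(* For each $\nu>-1$ the radius of starlikeness $r^\star(w_\nu)$ satisfies $r^\star(w_\nu)<16(\nu+1)^2(\nu+2)$. Moreover, under the same condition $\nu>-1$, $$8(\nu+1)^2(\nu+2)<r^\star(w_\nu)<\frac{32(\nu+1)(\nu+1)_4}{\nu^2+22\nu+45},$$ $$16(\nu+1)^2(\nu+2)\sqrt{\frac{(\nu+3)(\nu+4)}{\nu^2+22\nu+45}}<r^\star(w_\nu)<\frac{16(\nu+1)(\nu+1)_3(\nu+5)_2(\nu^2+22\nu+45)}{\nu_{11}}$$ and $$16(\nu+1)^2(\nu+2)\sqrt[3]{\frac{(\nu+3)(\nu+3)_4}{\nu_{11}}}<r^\star(w_\nu)<\frac{16(\nu+1)^2(\nu+2)(\nu+4)(\nu+7)(\nu+8)\nu_{11}}{\nu_{12}},$$ where $$\nu_{11}=\nu^5+36\nu^4+584\nu^3+3554\nu^2+8919\nu+7834$$ and $$\nu_{12}=\nu^8+60\nu^7+1610\nu^6+25303\nu^5+229535\nu^4+1199202\nu^3+3542412\nu^2+5461979\nu+3396826.$$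
   Context: For $\nu>-1$, with $J_\nu,I_\nu$ the Bessel and modified Bessel functions of the first kind, $$\mathbf{\Pi}_\nu(z)=J_\nu(z)I_\nu(z)=\sum_{n\ge0}\frac{(-1)^n(z/2)^{2\nu+4n}}{n!\,\Gamma(\nu+n+1)\Gamma(\nu+2n+1)},$$ $$w_\nu(z)=2^{2\nu}z^{-\frac{\nu}{2}+1}\Gamma^2(\nu+1)\mathbf{\Pi}_\nu(\sqrt[4]{z})=\sum_{n\ge0}\frac{(-1)^n z^{n+1}}{2^{4n}n!\,(\nu+1)_n(\nu+1)_{2n}}.$$ The radius of starlikeness is $r^\star(f)=\sup\{r>0:\operatorname{Re}(zf'(z)/f(z))>0\text{ for all }|z|<r\}$. Pochhammer symbol: $(a)_0=1$, $(a)_n=a(a+1)\cdots(a+n-1)$. *)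

(* Defs.v *)
From Stdlib Require Import Reals Factorial.
From Coquelicot Require Import Coquelicot.
Open Scope R_scope.

(* Euler's integral; it converges exactly for 0 < x. *)
Definition Gamma (x : R) : R :=
  RInt_gen (fun t => Rpower t (x - 1) * exp (- t))
           (at_right 0) (Rbar_locally p_infty).

Fixpoint pochhammer (a : R) (n : nat) : R :=
  match n with
  | O => 1
  | S m => pochhammer a m * (a + INR m)
  end.

(* Principal argument, in (-PI, PI], for z <> 0. *)
Definition Carg (z : C) : R :=
  if Rle_dec 0 (Im z) then acos (Re z / Cmod z) else - acos (Re z / Cmod z).

(* Principal branch of z^a for a real exponent a; 0^0 = 1, and 0^a = 0 for
   every a <> 0 (a junk value if a < 0). *)
Definition Cpowr (z : C) (a : R) : C :=
  if Ceq_dec z (RtoC 0) then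
    if Req_EM_T a 0 then RtoC 1 else RtoC 0
  else
    (Rpower (Cmod z) a * cos (a * Carg z), Rpower (Cmod z) a * sin (a * Carg z)).

Definition CSeries (u : nat -> C) : C :=
  (Series (fun n => Re (u n)), Series (fun n => Im (u n))).

Definition BesselJ (nu : R) (z : C) : C :=
  CSeries (fun n =>
    (RtoC ((-1) ^ n / (INR (fact n) * Gamma (nu + INR n + 1)))
     * Cpowr (z / RtoC 2) (nu + 2 * INR n))%C).

Definition BesselI (nu : R) (z : C) : C :=
  CSeries (fun n =>
    (RtoC (1 / (INR (fact n) * Gamma (nu + INR n + 1)))
     * Cpowr (z / RtoC 2) (nu + 2 * INR n))%C).

Definition JI_product (nu : R) (z : C) : C := (BesselJ nu z * BesselI nu z)%C.

(* All powers are principal. They are mutually consistent: z^(1/4) has argument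
   Carg z / 4, so the factor (z^(1/4))^(2 nu) in JI_product nu (z^(1/4)) cancels
   z^(- nu/2) for every z <> 0, branch cut included. Hence w nu is the entire
   function sum_n (-1)^n z^(n+1) / (2^(4n) n! (nu+1)_n (nu+1)_(2n)); the value at
   0 is 0. *)
Definition w (nu : R) (z : C) : C :=
  (RtoC (Rpower 2 (2 * nu)) * Cpowr z (- nu / 2 + 1)
   * RtoC (Gamma (nu + 1) ^ 2) * JI_product nu (Cpowr z (1 / 4)))%C.

(* The functions f of interest satisfy f 0 = 0 and f'(0) = 1, so that
   z f'(z) / f(z) has a removable singularity with value 1 at z = 0; this point
   is excluded. The condition f z <> 0 says that the quotient is defined at the
   remaining points. *)
Definition starlike_in_disc (f : C -> C) (r : R) : Prop :=
  forall z : C, z <> RtoC 0 -> Cmod z < r ->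
    f z <> RtoC 0 /\
    exists d : C, is_derive (K := C_AbsRing) (V := C_NormedModule) f z d /\
                  0 < Re (z * d / f z)%C.

(* The supremum is taken in the extended reals: it is +oo if the set is
   unbounded and -oo if it is empty. *)
Definition radius_starlike (f : C -> C) : Rbar :=
  Lub_Rbar (fun r : R => 0 < r /\ starlike_in_disc f r).

Definition nu11 (nu : R) : R :=
  nu ^ 5 + 36 * nu ^ 4 + 584 * nu ^ 3 + 3554 * nu ^ 2 + 8919 * nu + 7834.

Definition nu12 (nu : R) : R :=
  nu ^ 8 + 60 * nu ^ 7 + 1610 * nu ^ 6 + 25303 * nu ^ 5 + 229535 * nu ^ 4
  + 1199202 * nu ^ 3 + 3542412 * nu ^ 2 + 5461979 * nu + 3396826.

(* The real cube root, for 0 < x. *)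
Definition cbrt (x : R) : R := Rpower x (1 / 3).

(* Main.v *)
Require Import Defs.
From Stdlib Require Import Reals.
From Stdlib Require Import Factorial Lra Lia List ClassicalEpsilon.
From Coquelicot Require Import Coquelicot.
Open Scope R_scope.

(** Write [g u = sum (-u)^k / (4^k k! (nu+1)_k)].  Unfolding the principal powers gives
[w nu z = z * g s * g (- s)] for every [s] with [s^2 = z].  The zeros of [g] are known
to be positive; if [1 / t_i] are these zeros, then [w z = z * prod (1 - t_i^2 z)],
and the derivative of [w] is [prod (1 - c_i z)] with all [c_i] positive, because
differentiation preserves real zeros.  The radius of starlikeness is then the
smallest zero [1 / c_1] of the derivative: for [|z| = r] below it,
[Re (z w' / w) >= r w'(r) / w(r) > 0].  The bounds are Euler-Rayleigh
inequalities for the sums [sigma_k = sum c_i^k], which are rational in [nu]: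
[c_1^k < sigma_k] gives the lower bounds and [sigma_(k+1) < c_1 sigma_k] the upper ones.

No infinite product is used.  The function [g] is the limit of the Laguerre polynomials
[sum C(N,k) (-u/(4N))^k / (nu+1)_k], whose roots are positive and distinct because the
polynomial of degree [N+1] is obtained from the one of degree [N] by
[p -> p + x p' / b - x p / b] with [b = N + 1 + nu], and this operator forces a sign
change between consecutive roots ([step_raises_degree]).  The operator [p -> p + x p'],
which sends [p] to the derivative of [x p], does the same ([step_keeps_degree]).
So every object above has a polynomial version of degree [N] ([approximant]), and four
facts survive the limit: the values and derivatives ([w_limit], [w_derivative]), the
power sums up to order four through Newton's identities ([power_sum_lim]), the lower
bound on [Re (z w' / w)] ([starlike_of_largest]), and the vanishing of the derivative
of [w] at a cluster point of [1 / c_1] ([not_starlike_of_largest]).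

Strictness has to be kept in the limit.  Cauchy-Schwarz applied to the terms other than
[c_1] improves the Rayleigh inequalities of highest order by an explicit amount
([largest_upper], [largest_lower]), which stays positive because
[sigma_3^2 < sigma_2^3] and [sigma_3^2 < sigma_2 sigma_4].  These two, and the
comparisons that deduce the weaker bounds from the strongest ones, are, up to positive
denominators, inequalities
between polynomials in [nu + 1] whose differences have nonnegative coefficients. *)

(** * The Gamma function at positive arguments *)

Definition gamma_integrand (x t : R) : R := Rpower t (x - 1) * exp (- t).

Lemma Rpower_derive (y t : R) : 0 < t ->
  is_derive (fun s => Rpower s y) t (y * Rpower t (y - 1)).
Proof.
intros Ht; apply is_derive_Reals.
now apply derivable_pt_lim_power.
Qed.

Lemma gamma_integrand_continuous (x t : R) : 0 < t ->
  continuous (gamma_integrand x) t.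
Proof.
intros Ht; apply (ex_derive_continuous (gamma_integrand x) t).
eexists; unfold gamma_integrand.
apply (is_derive_mult (fun s => Rpower s (x - 1)) (fun s => exp (- s))).
- now apply Rpower_derive.
- auto_derive; [exact I | reflexivity].
- intros n m; apply Rmult_comm.
Qed.

Lemma gamma_integrand_pos (x t : R) : 0 < gamma_integrand x t.
Proof. apply Rmult_lt_0_compat; apply exp_pos. Qed.

Lemma gamma_integrand_integrable (x a b : R) : 0 < a -> 0 < b ->
  ex_RInt (gamma_integrand x) a b.
Proof.
intros Ha Hb; apply (ex_RInt_continuous (V := R_CompleteNormedModule)).
intros t Ht; apply gamma_integrand_continuous.
apply Rlt_le_trans with (2 := proj1 Ht); now apply Rmin_glb_lt.
Qed.

(** The constant is the one for which [ln (u / y) <= u / y - 1], multiplied by [y],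
gives the bound with [u = 1 + t]. *)
Lemma exp_dominates_Rpower (y t : R) : 0 < y -> 0 < t ->
  Rpower (1 + t) y <= exp (1 - y + y * ln y) * exp t.
Proof.
intros Hy Ht; rewrite <- exp_plus; unfold Rpower.
assert (H : ln ((1 + t) / y) <= (1 + t) / y - 1).
{ assert (P : 0 < (1 + t) / y) by (apply Rdiv_lt_0_compat; lra).
  pose proof (exp_ineq1_le (ln ((1 + t) / y))) as E.
  rewrite exp_ln in E by exact P; lra. }
rewrite ln_div in H by lra.
apply Rmult_le_compat_l with (r := y) in H; [|lra].
replace (y * ((1 + t) / y - 1)) with (1 + t - y) in H by (field; lra).
destruct (Rle_lt_or_eq_dec (y * ln (1 + t)) (1 - y + y * ln y + t)) as [L|L].
- lra.
- left; now apply exp_increasing.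
- right; now rewrite L.
Qed.

(** One majorant serves at both ends of the half-line: up to a constant, the integrand is
below [x t^(x-1) (1+t)^(-x-1)], the derivative of the function [(t / (1+t))^x], which has
values in [0, 1]. *)
Lemma gamma_integral_bounded (x : R) : 0 < x ->
  exists M, forall a b, 0 < a -> a <= b -> RInt (gamma_integrand x) a b <= M.
Proof.
intros Hx.
set (K := exp (1 - (x + 1) + (x + 1) * ln (x + 1)) / x).
assert (HK : 0 < K) by (apply Rdiv_lt_0_compat; [apply exp_pos | lra]).
set (H := fun t => K * Rpower (t / (1 + t)) x).
set (h := fun t => K * (x * Rpower (t / (1 + t)) (x - 1) * (/ (1 + t) ^ 2))).
exists K; intros a b Ha Hab.
assert (Hd : forall t, 0 < t -> is_derive H t (h t)).
{ intros t Ht; unfold H, h.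
  apply (is_derive_scal (fun t => Rpower (t / (1 + t)) x)).
  replace (x * Rpower (t / (1 + t)) (x - 1) * / (1 + t) ^ 2)
    with (scal (/ (1 + t) ^ 2) (x * Rpower (t / (1 + t)) (x - 1)))
    by (unfold scal; simpl; unfold mult; simpl; ring).
  apply (is_derive_comp (fun s => Rpower s x) (fun t => t / (1 + t))).
  - apply Rpower_derive, Rdiv_lt_0_compat; lra.
  - auto_derive; [lra | field; lra]. }
assert (Hc : forall t, 0 < t -> continuous h t).
{ intros t Ht; apply (ex_derive_continuous h); eexists; unfold h.
  apply (is_derive_scal (fun t => x * Rpower (t / (1 + t)) (x - 1) * (/ (1 + t) ^ 2))).
  apply (is_derive_mult (fun t => x * Rpower (t / (1 + t)) (x - 1)) (fun t => / (1 + t) ^ 2)).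
  - apply (is_derive_scal (fun t => Rpower (t / (1 + t)) (x - 1))).
    apply (is_derive_comp (fun s => Rpower s (x - 1)) (fun t => t / (1 + t))).
    + apply Rpower_derive, Rdiv_lt_0_compat; lra.
    + auto_derive; [lra | reflexivity].
  - auto_derive; [|reflexivity]. apply Rmult_integral_contrapositive; split; [lra|].
    apply Rmult_integral_contrapositive; lra.
  - intros n m; apply Rmult_comm. }
assert (Hi : is_RInt h a b (H b - H a)).
{ apply (is_RInt_derive H h).
  - intros t Ht; rewrite Rmin_left in Ht by lra; apply Hd; lra.
  - intros t Ht; rewrite Rmin_left in Ht by lra; apply Hc; lra. }
apply Rle_trans with (RInt h a b).
- apply RInt_le; [exact Hab| apply gamma_integrand_integrable; lra | eexists; exact Hi |].
  intros t Ht; unfold gamma_integrand, h.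
  assert (T : 0 < t) by lra.
  replace (Rpower (t / (1 + t)) (x - 1)) with (Rpower t (x - 1) * / Rpower (1 + t) (x - 1)).
  2:{ unfold Rpower; rewrite ln_div by lra; rewrite <- exp_Ropp, <- exp_plus.
      f_equal; ring. }
  replace ((1 + t) ^ 2) with (Rpower (1 + t) 2)
    by (rewrite <- Rpower_pow by lra; f_equal; simpl; ring).
  replace (K * (x * (Rpower t (x - 1) * / Rpower (1 + t) (x - 1)) * / Rpower (1 + t) 2))
    with (Rpower t (x - 1) * (K * x / (Rpower (1 + t) (x - 1) * Rpower (1 + t) 2))).
  2:{ field; split; apply Rgt_not_eq, exp_pos. }
  rewrite <- Rpower_plus; replace (x - 1 + 2) with (x + 1) by ring.
  apply Rmult_le_compat_l; [left; apply exp_pos|].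
  rewrite exp_Ropp; unfold K.
  pose proof (exp_dominates_Rpower (x + 1) t ltac:(lra) T) as E.
  set (A := exp (1 - (x + 1) + (x + 1) * ln (x + 1))) in *.
  assert (P : 0 < Rpower (1 + t) (x + 1)) by apply exp_pos.
  assert (Q : 0 < exp t) by apply exp_pos.
  apply Rmult_le_reg_r with (exp t * Rpower (1 + t) (x + 1)); [now apply Rmult_lt_0_compat|].
  replace (/ exp t * (exp t * Rpower (1 + t) (x + 1))) with (Rpower (1 + t) (x + 1))
    by (field; lra).
  replace (A / x * x / Rpower (1 + t) (x + 1) * (exp t * Rpower (1 + t) (x + 1)))
    with (A * exp t) by (field; lra).
  exact E.
- rewrite (is_RInt_unique _ _ _ _ Hi).
  assert (0 < H a) by (apply Rmult_lt_0_compat; [lra | apply exp_pos]).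
  assert (Rpower (b / (1 + b)) x <= 1).
  { assert (0 < b / (1 + b) < 1).
    { split; [apply Rdiv_lt_0_compat; lra|].
      apply Rmult_lt_reg_r with (1 + b); [lra|].
      replace (b / (1 + b) * (1 + b)) with b by (field; lra); lra. }
    assert (ln (b / (1 + b)) < 0) by (rewrite <- ln_1; apply ln_increasing; lra).
    apply Rle_trans with (exp 0); [|rewrite exp_0; lra].
    left; apply exp_increasing; nra. }
  assert (H b <= K) by (unfold H; nra). lra.
Qed.

Lemma gamma_integral_monotone (x a b a' b' : R) :
  0 < a' -> a' <= a -> a <= b -> b <= b' ->
  RInt (gamma_integrand x) a b <= RInt (gamma_integrand x) a' b'.
Proof.
intros H1 H2 H3 H4.
assert (P : forall c d, 0 < c -> c <= d -> 0 <= RInt (gamma_integrand x) c d).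
{ intros c d Hc Hd; apply RInt_ge_0; [exact Hd| apply gamma_integrand_integrable; lra|].
  intros t _; left; apply gamma_integrand_pos. }
rewrite <- (RInt_Chasles (gamma_integrand x) a' a b')
  by (apply gamma_integrand_integrable; lra).
rewrite <- (RInt_Chasles (gamma_integrand x) a b b')
  by (apply gamma_integrand_integrable; lra).
pose proof (P a' a H1 H2). pose proof (P b b' ltac:(lra) H4).
unfold plus; simpl; lra.
Qed.

(** The integrals over compact intervals increase with the interval, so they converge
to their supremum. *)
Lemma gamma_converges (x : R) : 0 < x ->
  exists l, 0 < l /\
    is_RInt_gen (gamma_integrand x) (at_right 0) (Rbar_locally p_infty) l.
Proof.
intros Hx; destruct (gamma_integral_bounded x Hx) as [M HM].
set (E := fun r => exists a b, 0 < a /\ a <= b /\ r = RInt (gamma_integrand x) a b).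
destruct (completeness E) as [l [Hub Hl]].
- exists M; intros r (a & b & Ha & Hb & ->); now apply HM.
- exists (RInt (gamma_integrand x) 1 2), 1, 2; repeat split; lra.
- exists l; split.
  + apply Rlt_le_trans with (RInt (gamma_integrand x) 1 2).
    * apply RInt_gt_0; [lra| intros; apply gamma_integrand_pos|].
      intros t Ht; apply gamma_integrand_continuous; lra.
    * apply Hub; exists 1, 2; repeat split; lra.
  + intros P [eps HP].
    assert (exists a b, 0 < a /\ a <= b /\ l - eps < RInt (gamma_integrand x) a b)
      as (a & b & Ha & Hb & Hab).
    { destruct (classic (exists a b, 0 < a /\ a <= b /\
        l - eps < RInt (gamma_integrand x) a b)) as [Y|N]; [exact Y|].
      exfalso; assert (l <= l - eps); [|pose proof (cond_pos eps); lra].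
      apply Hl; intros r (a & b & Ha & Hb & ->).
      apply Rnot_lt_le; intros C; apply N; now exists a, b. }
    unfold filtermapi.
    apply (Filter_prod _ _ _ (fun s => 0 < s <= a) (fun s => b <= s)).
    * exists (mkposreal a Ha); intros s Hs Hs0; split; [exact Hs0|].
      unfold ball in Hs; simpl in Hs; unfold AbsRing_ball, abs, minus, plus, opp in Hs; simpl in Hs.
      rewrite Rabs_right in Hs by lra; lra.
    * exists b; intros s Hs; lra.
    * intros s t Hs Ht; simpl.
      exists (RInt (gamma_integrand x) s t); split.
      -- apply (RInt_correct (V := R_CompleteNormedModule)), gamma_integrand_integrable; lra.
      -- apply HP.
         unfold ball; simpl; unfold AbsRing_ball, abs, minus, plus, opp; simpl.
         assert (RInt (gamma_integrand x) s t <= l)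
           by (apply Hub; exists s, t; repeat split; lra).
         pose proof (gamma_integral_monotone x a b s t).
         apply Rabs_def1; pose proof (cond_pos eps); lra.
Qed.

Lemma Gamma_is_integral (x : R) : 0 < x ->
  is_RInt_gen (gamma_integrand x) (at_right 0) (Rbar_locally p_infty) (Gamma x)
  /\ 0 < Gamma x.
Proof.
intros Hx; destruct (gamma_converges x Hx) as (l & Hl & H).
unfold Gamma; fold (gamma_integrand x).
rewrite (is_RInt_gen_unique _ _ H); now split.
Qed.

Lemma gamma_boundary_zero (x : R) : 0 < x ->
  filterlim (gamma_integrand (x + 1)) (at_right 0) (locally 0).
Proof.
intros Hx P [eps HP].
exists (mkposreal (Rpower eps (/ x)) (exp_pos _)); intros t Ht Ht0.
apply HP; unfold ball in *; simpl in *.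
unfold AbsRing_ball, abs, minus, plus, opp in *; simpl in *.
rewrite Ropp_0, Rplus_0_r in *.
rewrite Rabs_right in Ht by lra.
rewrite Rabs_right by (left; apply gamma_integrand_pos).
unfold gamma_integrand; replace (x + 1 - 1) with x by ring.
apply Rle_lt_trans with (Rpower t x * 1).
- apply Rmult_le_compat_l; [left; apply exp_pos|].
  rewrite <- exp_0; left; apply exp_increasing; lra.
- rewrite Rmult_1_r.
  replace (pos eps) with (Rpower (Rpower eps (/ x)) x).
  + apply Rlt_Rpower_l; lra.
  + rewrite Rpower_mult, Rinv_l by lra; apply Rpower_1, cond_pos.
Qed.

Lemma gamma_boundary_infinity (x : R) : 0 < x ->
  filterlim (gamma_integrand (x + 1)) (Rbar_locally p_infty) (locally 0).
Proof.
intros Hx.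
set (K := exp (1 - (x + 1) + (x + 1) * ln (x + 1))).
assert (HK : 0 < K) by apply exp_pos.
intros P [eps HP].
exists (K / eps); intros t Ht; apply HP.
pose proof (cond_pos eps) as He.
assert (T : 0 < t) by (pose proof (Rdiv_lt_0_compat K eps HK He); lra).
unfold ball; simpl; unfold AbsRing_ball, abs, minus, plus, opp; simpl.
rewrite Ropp_0, Rplus_0_r.
rewrite Rabs_right by (left; apply gamma_integrand_pos).
unfold gamma_integrand; replace (x + 1 - 1) with x by ring.
pose proof (exp_dominates_Rpower (x + 1) t ltac:(lra) T) as E; fold K in E.
rewrite Rpower_plus, Rpower_1 in E by lra.
assert (Rpower t x <= Rpower (1 + t) x) by (apply Rle_Rpower_l; lra).
assert (Q : 0 < exp t) by apply exp_pos.
assert (0 < Rpower t x) by apply exp_pos.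
rewrite exp_Ropp.
assert (K < t * eps).
{ apply Rmult_lt_reg_r with (/ eps); [now apply Rinv_0_lt_compat|].
  replace (t * eps * / eps) with t by (field; lra); exact Ht. }
apply Rmult_lt_reg_r with (t * exp t); [nra|].
replace (Rpower t x * / exp t * (t * exp t)) with (Rpower t x * t) by (field; lra).
apply Rle_lt_trans with (K * exp t); nra.
Qed.

(** Integration by parts: the derivative of [t^x exp (- t)] integrates to 0, because this
function vanishes at both ends. *)
Lemma Gamma_recurrence (x : R) : 0 < x -> Gamma (x + 1) = x * Gamma x.
Proof.
intros Hx.
destruct (Gamma_is_integral x Hx) as [H0 _].
destruct (Gamma_is_integral (x + 1) ltac:(lra)) as [H1 _].
assert (D : forall t, 0 < t ->
  is_derive (gamma_integrand (x + 1)) t (x * gamma_integrand x t - gamma_integrand (x + 1) t)).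
{ intros t Ht.
  replace (x * gamma_integrand x t - gamma_integrand (x + 1) t)
    with ((x + 1 - 1) * Rpower t (x + 1 - 1 - 1) * exp (- t)
      + Rpower t (x + 1 - 1) * (- exp (- t))).
  - unfold gamma_integrand at 1.
    apply (is_derive_mult (fun s => Rpower s (x + 1 - 1)) (fun s => exp (- s))).
    + now apply Rpower_derive.
    + auto_derive; [exact I | ring].
    + intros n m; apply Rmult_comm.
  - unfold gamma_integrand; replace (x + 1 - 1 - 1) with (x - 1) by ring; ring. }
assert (Near : filter_prod (at_right 0) (Rbar_locally p_infty)
  (fun ab : R * R => forall t, Rmin (fst ab) (snd ab) <= t <= Rmax (fst ab) (snd ab) -> 0 < t)).
{ apply (Filter_prod _ _ _ (fun s => 0 < s) (fun s => 0 < s)).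
  - exists (mkposreal 1 Rlt_0_1); intros s _ Hs; exact Hs.
  - exists 0; intros s Hs; exact Hs.
  - intros a b Ha Hb t Ht; simpl in Ht.
    apply Rlt_le_trans with (2 := proj1 Ht); now apply Rmin_glb_lt. }
assert (B : is_RInt_gen (Derive (gamma_integrand (x + 1)))
              (at_right 0) (Rbar_locally p_infty) (0 - 0)).
{ apply is_RInt_gen_Derive.
  - revert Near; apply filter_imp; intros ab H t Ht; eexists; apply D, (H t Ht).
  - revert Near; apply filter_imp; intros ab H t Ht.
    assert (T : 0 < t) by apply (H t Ht).
    apply continuous_ext_loc with
      (fun t => x * gamma_integrand x t - gamma_integrand (x + 1) t).
    + exists (mkposreal t T); intros s Hs.
      symmetry; apply is_derive_unique, D.
      unfold ball in Hs; simpl in Hs.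
      unfold AbsRing_ball, abs, minus, plus, opp in Hs; simpl in Hs.
      apply Rabs_def2 in Hs; lra.
    + apply (continuous_minus (fun t => x * gamma_integrand x t) (gamma_integrand (x + 1))).
      * apply (continuous_scal_r x (gamma_integrand x)), gamma_integrand_continuous, T.
      * now apply gamma_integrand_continuous.
  - now apply gamma_boundary_zero.
  - now apply gamma_boundary_infinity. }
assert (B' : is_RInt_gen (Derive (gamma_integrand (x + 1)))
  (at_right 0) (Rbar_locally p_infty) (x * Gamma x - Gamma (x + 1))).
{ apply is_RInt_gen_ext with
    (fun t => minus (scal x (gamma_integrand x t)) (gamma_integrand (x + 1) t)).
  - revert Near; apply filter_imp; intros ab H t Ht.
    symmetry; apply is_derive_unique, D, (H t); lra.
  - apply (is_RInt_gen_minus (fun t => scal x (gamma_integrand x t)) (gamma_integrand (x + 1))).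
    + apply (is_RInt_gen_scal (gamma_integrand x) x); exact H0.
    + exact H1. }
pose proof (is_RInt_gen_unique _ _ B) as E1.
pose proof (is_RInt_gen_unique _ _ B') as E2.
simpl in E1, E2. rewrite E1 in E2; lra.
Qed.

Lemma Gamma_shift (x : R) (n : nat) : 0 < x ->
  Gamma (x + INR n) = Gamma x * pochhammer x n.
Proof.
intros Hx; induction n as [|n IH].
- simpl; rewrite Rplus_0_r; ring.
- rewrite S_INR; replace (x + (INR n + 1)) with (x + INR n + 1) by ring.
  rewrite Gamma_recurrence, IH by (pose proof (pos_INR n); lra).
  simpl; ring.
Qed.

(** * Polynomials as products of linear factors *)

(** Elementary symmetric functions; the recursion on the list makes each identity between
them an induction closed by [ring]. *)
Fixpoint elem_sym (k : nat) (l : list R) : R :=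
  match l with
  | nil => match k with O => 1 | S _ => 0 end
  | y :: l' => elem_sym k l' + match k with O => 0 | S j => y * elem_sym j l' end
  end.

Definition coef (l : list R) (k : nat) : R := (-1) ^ k * elem_sym k l.

Arguments coef : simpl never.

(** Polynomials are recorded by the reciprocals of their roots: the value at 0 is then 1,
and the power sums of the list are the Rayleigh sums. *)
Fixpoint prodC (l : list R) (z : C) : C :=
  match l with
  | nil => 1
  | y :: l' => (1 - y * z) * prodC l' z
  end%C.

Fixpoint dprodC (l : list R) (z : C) : C :=
  match l with
  | nil => 0
  | y :: l' => - y * prodC l' z + (1 - y * z) * dprodC l' z
  end%C.

Fixpoint prodR (l : list R) (x : R) : R :=
  match l with
  | nil => 1
  | y :: l' => (1 - y * x) * prodR l' x
  end.

Fixpoint dprodR (l : list R) (x : R) : R :=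
  match l with
  | nil => 0
  | y :: l' => - y * prodR l' x + (1 - y * x) * dprodR l' x
  end.

Fixpoint polyC (a : nat -> R) (n : nat) (z : C) : C :=
  match n with
  | O => a O
  | S m => polyC a m z + a (S m) * z ^ S m
  end%C.

Definition polyR (a : nat -> R) (n : nat) (x : R) : R :=
  sum_f_R0 (fun k => a k * x ^ k) n.

Lemma prodC_RtoC (l : list R) (x : R) : prodC l x = prodR l x.
Proof.
induction l as [|y l IH]; simpl; [reflexivity|].
rewrite IH, RtoC_mult, RtoC_minus, RtoC_mult; reflexivity.
Qed.

Lemma dprodC_RtoC (l : list R) (x : R) : dprodC l x = dprodR l x.
Proof.
induction l as [|y l IH]; simpl; [reflexivity|].
rewrite IH, prodC_RtoC, RtoC_plus, !RtoC_mult, RtoC_minus, RtoC_mult, RtoC_opp; reflexivity.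
Qed.

Lemma polyC_RtoC (a : nat -> R) (n : nat) (x : R) : polyC a n x = polyR a n x.
Proof.
unfold polyR; induction n as [|n IH].
- simpl; f_equal; ring.
- rewrite tech5, RtoC_plus, RtoC_mult, RtoC_pow, <- IH; reflexivity.
Qed.

Lemma coef_0 (l : list R) : coef l 0 = 1.
Proof. unfold coef; induction l as [|y l IH]; simpl in *; lra. Qed.

Lemma coef_cons (t : R) (l : list R) (k : nat) :
  coef (t :: l) (S k) = coef l (S k) - t * coef l k.
Proof. unfold coef; simpl; ring. Qed.

Lemma coef_overflow (l : list R) (k : nat) : (length l < k)%nat -> coef l k = 0.
Proof.
revert k; induction l as [|t l IH]; intros k Hk.
- destruct k; [inversion Hk|]; unfold coef; simpl; ring.
- destruct k; [inversion Hk|]; simpl in Hk.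
  rewrite coef_cons, (IH (S k)), (IH k) by lia; ring.
Qed.

Lemma prodC_expand (l : list R) (z : C) (m : nat) : (length l <= m)%nat ->
  prodC l z = polyC (coef l) m z.
Proof.
assert (H0 : forall m, polyC (coef nil) m z = 1%C).
{ intros p; induction p as [|n IH]; simpl; [now rewrite coef_0|].
  rewrite IH, (coef_overflow nil (S n)) by (simpl; lia); ring. }
assert (HS : forall t l m, polyC (coef (t :: l)) (S m) z
    = (polyC (coef l) (S m) z - t * z * polyC (coef l) m z)%C).
{ clear; intros t l m; induction m as [|m IH].
  - simpl; rewrite coef_cons, !coef_0, RtoC_minus, RtoC_mult; ring.
  - remember (S m) as p; simpl polyC at 1; rewrite IH, coef_cons; subst p.
    simpl; rewrite RtoC_minus, RtoC_mult; ring. }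
revert m; induction l as [|t l IH]; intros m Hm; [now rewrite H0|].
destruct m as [|m]; [inversion Hm|]; simpl in Hm.
rewrite HS, <- !IH by lia; simpl; ring.
Qed.

Lemma dprodC_expand (l : list R) (z : C) (m : nat) : (length l <= m)%nat ->
  (z * dprodC l z)%C = polyC (fun k => INR k * coef l k) m z.
Proof.
assert (H0 : forall m, polyC (fun k => INR k * coef nil k) m z = 0%C).
{ intros p; induction p as [|n IH]; [simpl; f_equal; ring|].
  cbn [polyC]; rewrite IH, (coef_overflow nil (S n)), Rmult_0_r by (simpl; lia); ring. }
assert (HS : forall t l m, polyC (fun k => INR k * coef (t :: l) k) (S m) z
    = (polyC (fun k => (INR k * coef l k)%R) (S m) z
       - t * z * (polyC (fun k => (INR k * coef l k)%R) m z + polyC (coef l) m z))%C).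
{ clear; intros t l m; induction m as [|m IH].
  - cbn [polyC]; rewrite coef_cons, !coef_0; simpl INR.
    rewrite !RtoC_mult, !RtoC_minus, !RtoC_mult; simpl; ring.
  - remember (S m) as p; cbn [polyC]; rewrite IH, coef_cons; subst p; cbn [polyC].
    rewrite !RtoC_mult, RtoC_minus, RtoC_mult, (S_INR (S m)), RtoC_plus; simpl Cpow; ring. }
revert m; induction l as [|t l IH]; intros m Hm; [rewrite H0; simpl; ring|].
destruct m as [|m]; [inversion Hm|]; simpl in Hm.
rewrite HS, <- !IH, <- prodC_expand by lia; simpl; ring.
Qed.

Lemma prodR_expand (l : list R) (x : R) (m : nat) : (length l <= m)%nat ->
  prodR l x = polyR (coef l) m x.
Proof.
intros H; apply RtoC_inj; rewrite <- prodC_RtoC, <- polyC_RtoC; now apply prodC_expand.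
Qed.

Lemma dprodR_expand (l : list R) (x : R) (m : nat) : (length l <= m)%nat ->
  x * dprodR l x = polyR (fun k => INR k * coef l k) m x.
Proof.
intros H; apply RtoC_inj; rewrite RtoC_mult, <- dprodC_RtoC, <- polyC_RtoC.
now apply dprodC_expand.
Qed.

(** Power series quotient of [a] by [1 - t x]. *)
Fixpoint synth_div (t : R) (a : nat -> R) (k : nat) : R :=
  match k with
  | O => a O
  | S j => a (S j) + t * synth_div t a j
  end.

Lemma synth_div_spec (t : R) (a : nat -> R) (m : nat) (x : R) :
  polyR a m x = (1 - t * x) * polyR (synth_div t a) m x + t * synth_div t a m * x ^ S m.
Proof.
unfold polyR; induction m as [|m IH]; [simpl; ring|].
rewrite !tech5, IH; simpl; ring.
Qed.

(** A polynomial with constant term 1 is determined by as many distinct nonzero roots as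
its degree: synthetic division removes one linear factor at a time. *)
Lemma coef_of_roots (l : list R) (a : nat -> R) :
  NoDup l -> (forall t, In t l -> t <> 0) ->
  a O = 1 -> (forall k, (length l < k)%nat -> a k = 0) ->
  (forall t, In t l -> polyR a (length l) (/ t) = 0) ->
  forall k, a k = coef l k.
Proof.
revert a; induction l as [|t l IH]; intros a Hd Hn H0 Hz Hr k.
- destruct k; [now rewrite coef_0|].
  rewrite coef_overflow, Hz; simpl; auto with arith.
- inversion Hd as [|? ? Ht Hd']; subst.
  set (b := synth_div t a).
  assert (Hbn : b (S (length l)) = 0).
  { pose proof (Hr t (or_introl eq_refl)) as E; simpl length in E.
    pose proof (Hn t (or_introl eq_refl)) as Nt.
    rewrite (synth_div_spec t) in E; fold b in E.
    replace (1 - t * / t) with 0 in E by (field; exact Nt).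
    rewrite Rmult_0_l, Rplus_0_l in E.
    apply Rmult_integral in E; destruct E as [E|E].
    - apply Rmult_integral in E; tauto.
    - exfalso; revert E; apply pow_nonzero, Rinv_neq_0_compat, Nt. }
  assert (Hbz : forall k, (length l < k)%nat -> b k = 0).
  { intros j Hj; induction Hj as [|j Hj IHj]; [exact Hbn|].
    unfold b in *; simpl; rewrite IHj, Hz by (simpl; lia); ring. }
  assert (Hb : forall k, b k = coef l k).
  { apply IH; auto.
    - intros s Hs; apply Hn; now right.
    - intros s Hs; pose proof (Hr s (or_intror Hs)) as E; simpl length in E.
      pose proof (Hn s (or_intror Hs)) as Ns.
      rewrite (synth_div_spec t) in E; fold b in E.
      rewrite Hbn in E; unfold polyR in E; rewrite tech5 in E; rewrite Hbn in E.
      fold (polyR b (length l) (/ s)) in E.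
      assert (E' : (1 - t * / s) * polyR b (length l) (/ s) = 0) by lra.
      apply Rmult_integral in E'; destruct E' as [E'|E']; [|exact E'].
      exfalso; apply Ht; replace t with s; [exact Hs|].
      apply Rmult_eq_reg_r with (/ s); [|now apply Rinv_neq_0_compat].
      rewrite Rinv_r by exact Ns; lra. }
  destruct k as [|k]; [now rewrite coef_0|].
  rewrite coef_cons, <- !Hb; unfold b; simpl; ring.
Qed.

Fixpoint incr (x : R) (X : list R) : Prop :=
  match X with
  | nil => True
  | y :: X' => x < y /\ incr y X'
  end.

Lemma incr_above (x y : R) (X : list R) : incr x X -> In y X -> x < y.
Proof.
revert x; induction X as [|z X IH]; intros x; simpl; [tauto|].
intros [H1 H2] [->|H]; [exact H1|].
apply Rlt_trans with z; auto.
Qed.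

Lemma incr_weaken (x y : R) (X : list R) : x <= y -> incr y X -> incr x X.
Proof. destruct X; simpl; [tauto|]; intros H [H1 H2]; split; [lra|exact H2]. Qed.

Lemma incr_app (x B : R) (X : list R) :
  incr x X -> x < B -> (forall y, In y X -> y < B) -> incr x (X ++ B :: nil).
Proof.
revert x; induction X as [|z X IH]; intros x; simpl; [tauto|].
intros [H1 H2] H H'; split; [exact H1|]; apply IH; auto.
Qed.

Lemma incr_NoDup_inv (X : list R) : incr 0 X -> NoDup (map Rinv X).
Proof.
assert (H : forall x, 0 <= x -> incr x X -> NoDup (map Rinv X)).
2:{ apply H; lra. }
induction X as [|z X IH]; intros x Hx; simpl; [constructor|].
intros [H1 H2]; constructor.
- intros H; apply in_map_iff in H; destruct H as (y & E & Hy).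
  pose proof (incr_above _ _ _ H2 Hy).
  apply Rinv_eq_reg in E; lra.
- apply IH with z; [lra|exact H2].
Qed.

(** [s] carries the sign expected at the head of the list. *)
Fixpoint alternating (s : R) (f : R -> R) (X : list R) : Prop :=
  match X with
  | nil => True
  | x :: X' => 0 < s * f x /\ alternating (- s) f X'
  end.

Lemma alternating_ext (s : R) (f g : R -> R) (X : list R) :
  (forall x, In x X -> f x = g x) -> alternating s f X -> alternating s g X.
Proof.
revert s; induction X as [|x X IH]; intros s H; simpl; [tauto|].
intros [H1 H2]; split; [rewrite <- H; [exact H1|now left]|].
apply IH; [intros y Hy; apply H; now right|exact H2].
Qed.

Lemma alternating_opp (s : R) (f : R -> R) (X : list R) :
  alternating s (fun x => - f x) X -> alternating (- s) f X.
Proof.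
revert s; induction X as [|x X IH]; intros s; simpl; [tauto|].
intros [H1 H2]; split; [lra|]; now apply IH.
Qed.

Lemma alternating_app (s : R) (f : R -> R) (X Y : list R) :
  alternating s f (X ++ Y) -> alternating s f X.
Proof.
revert s; induction X as [|x X IH]; intros s; simpl; [tauto|].
intros [H1 H2]; split; [exact H1|]; now apply IH.
Qed.

Lemma prodR_pos (l : list R) (x : R) :
  (forall t, In t l -> t * x < 1) -> 0 < prodR l x.
Proof.
induction l as [|t l IH]; simpl; intros H; [lra|].
apply Rmult_lt_0_compat; [|apply IH; auto].
pose proof (H t (or_introl eq_refl)); lra.
Qed.

(** At a simple root the sign of the derivative is that of the product of the other factors,
so it flips from one root to the next.  The point [B] beyond all roots continues the
alternation with the sign of [- prodR].  The positive factors [c] let the lemma apply to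
any function with these signs. *)
Lemma alternating_dprodR (X : list R) (x0 B : R) (f : R -> R) :
  0 <= x0 -> incr x0 X -> (forall y, In y X -> y < B) ->
  (forall x, In x X -> exists c, 0 < c /\ f x = c * dprodR (map Rinv X) x) ->
  (exists c, 0 < c /\ f B = - c * prodR (map Rinv X) B) ->
  alternating (-1) f (X ++ B :: nil).
Proof.
revert x0 f; induction X as [|x X IH]; intros x0 f H0 Hi HB Hx Hf; simpl.
- destruct Hf as (c & Hc & E); simpl in E; split; [lra|exact I].
- simpl in Hi; destruct Hi as [Hi1 Hi2].
  assert (Px : 0 < / x) by (apply Rinv_0_lt_compat; lra).
  assert (Neg : forall y, x < y -> 0 < / x * y - 1).
  { intros y Hy; replace 1 with (/ x * x) by (field; lra); nra. }
  split.
  + destruct (Hx x (or_introl eq_refl)) as (c & Hc & ->); simpl.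
    rewrite Rinv_l by lra.
    assert (0 < prodR (map Rinv X) x).
    { apply prodR_pos; intros t Ht; apply in_map_iff in Ht.
      destruct Ht as (y & <- & Hy); pose proof (incr_above _ _ _ Hi2 Hy).
      apply Rmult_lt_reg_l with y; [lra|].
      replace (y * (/ y * x)) with x by (field; lra); lra. }
    assert (0 < c * / x * prodR (map Rinv X) x)
      by (repeat apply Rmult_lt_0_compat; lra).
    lra.
  + apply alternating_opp, (IH x); [lra|exact Hi2|intros y Hy; apply HB; now right| |].
    * intros y Hy; destruct (Hx y (or_intror Hy)) as (c & Hc & E).
      pose proof (Neg y (incr_above _ _ _ Hi2 Hy)).
      exists (c * (/ x * y - 1)); split; [nra|]; rewrite E; simpl.
      replace (prodR (map Rinv X) y) with 0; [ring|].
      clear -Hy Hi2 Hi1 H0.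
      assert (y <> 0) by (pose proof (incr_above _ _ _ Hi2 Hy); lra).
      clear -Hy H; induction X as [|z X IHX]; [inversion Hy|]; simpl.
      destruct Hy as [->|Hy]; [rewrite Rinv_l by exact H; ring|].
      rewrite <- IHX by exact Hy; ring.
    * destruct Hf as (c & Hc & E).
      pose proof (Neg B (HB x (or_introl eq_refl))).
      exists (c * (/ x * B - 1)); split; [nra|]; rewrite E; simpl; ring.
Qed.

(** The last clause keeps the information that the first new root precedes the first old
one: the smallest zero of the derivative lies below the smallest zero of the function. *)
Lemma alternating_roots (f : R -> R) (X : list R) (x0 s : R) :
  continuity f -> incr x0 X -> alternating s f (x0 :: X) ->
  exists Y, length Y = length X /\ incr x0 Y /\ (forall y, In y Y -> f y = 0) /\
    match X, Y with x :: _, y :: _ => y < x | _, _ => True end.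
Proof.
intros Hf; revert x0 s; induction X as [|x X IH]; intros x0 s Hi Ha.
- exists nil; simpl; repeat split; tauto.
- destruct Hi as [Hi1 Hi2]; destruct Ha as (Ha0 & Ha1 & Ha2).
  destruct (IH x (- s) Hi2 (conj Ha1 Ha2)) as (Y & HY1 & HY2 & HY3 & _).
  destruct (IVT (fun u => (- s) * f u) x0 x) as (y & Hy & Ey).
  + apply (continuity_scal f (- s) Hf).
  + exact Hi1.
  + lra.
  + exact Ha1.
  + assert (s <> 0) by (intros ->; lra).
    assert (f y = 0).
    { apply Rmult_integral in Ey; destruct Ey; [lra|assumption]. }
    assert (x0 < y) by (destruct (Req_dec x0 y) as [->|]; [nra|lra]).
    assert (y < x) by (destruct (Req_dec y x) as [->|]; [nra|lra]).
    exists (y :: Y); simpl; repeat split; auto.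
    * apply incr_weaken with x; [lra|exact HY2].
    * intros u [<-|Hu]; auto.
Qed.

Lemma polyR_continuity (a : nat -> R) (n : nat) : continuity (polyR a n).
Proof.
unfold polyR; induction n as [|n IH].
- simpl; intros x; apply continuity_pt_const; intros u v; ring.
- intros x; apply continuity_pt_ext with
    (fun x => sum_f_R0 (fun k => a k * x ^ k) n + a (S n) * x ^ S n).
  + intros; reflexivity.
  + apply (continuity_pt_plus (fun x => sum_f_R0 (fun k => a k * x ^ k) n)
      (fun x => a (S n) * x ^ S n)); [apply IH|].
    apply (continuity_pt_scal (fun x => x ^ S n)).
    apply derivable_continuous_pt, derivable_pt_pow.
Qed.

(** * Operators that preserve distinct positive roots *)

(** Coefficients of [p + x p' / b - c x p], where [p] is the product over [l]. *)
Definition step_coef (b c : R) (l : list R) (k : nat) : R :=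
  (1 + INR k / b) * coef l k - c * match k with O => 0 | S j => coef l j end.

Lemma step_coef_eval (b c : R) (l : list R) (x : R) (m : nat) :
  b <> 0 -> (length l <= m)%nat ->
  polyR (step_coef b c l) (S m) x = prodR l x + x * dprodR l x / b - c * x * prodR l x.
Proof.
intros Hb Hm.
assert (H : forall m, polyR (step_coef b c l) (S m) x
  = polyR (coef l) (S m) x + polyR (fun k => INR k * coef l k) (S m) x / b
    - c * x * polyR (coef l) m x).
{ clear m Hm; unfold polyR; intros m; induction m as [|m IH].
  - unfold step_coef; simpl; field; exact Hb.
  - rewrite (tech5 _ (S m)), IH, 2!(tech5 _ (S m)), (tech5 (fun k => coef l k * x ^ k) m).
    unfold step_coef; rewrite <- (tech_pow_Rmult x (S m)), <- (tech_pow_Rmult x m); field; exact Hb. }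
rewrite H, <- !prodR_expand, <- dprodR_expand by lia; reflexivity.
Qed.

Lemma step_coef_eval_0 (b : R) (l : list R) (x : R) (m : nat) :
  b <> 0 -> (length l <= m)%nat ->
  polyR (step_coef b 0 l) m x = prodR l x + x * dprodR l x / b.
Proof.
intros Hb Hm.
assert (H : forall m, polyR (step_coef b 0 l) m x
  = polyR (coef l) m x + polyR (fun k => INR k * coef l k) m x / b).
{ clear m Hm; unfold polyR; intros m; induction m as [|m IH].
  - unfold step_coef; simpl; field; exact Hb.
  - rewrite (tech5 _ m), IH, 2!(tech5 _ m).
    unfold step_coef; field; exact Hb. }
rewrite H, <- !prodR_expand, <- dprodR_expand by lia; reflexivity.
Qed.

(** The sign of [p + x p' / b - c x p] far to the right is that of [- p], since [x p' / p]
stays below twice the degree. *)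
Lemma log_derivative_bound (X : list R) (B : R) :
  (forall x, In x X -> 0 < x /\ 2 * x <= B) ->
  exists e, B * dprodR (map Rinv X) B = e * prodR (map Rinv X) B
    /\ e <= 2 * INR (length X).
Proof.
induction X as [|x X IH]; intros H.
- exists 0; simpl; lra.
- destruct IH as (e & E1 & E2); [intros y Hy; apply H; now right|].
  destruct (H x (or_introl eq_refl)) as [Hx HB].
  set (u := / x * B).
  assert (Hu : 2 <= u).
  { unfold u; apply Rmult_le_reg_l with x; [exact Hx|].
    replace (x * (/ x * B)) with B by (field; lra); lra. }
  exists (e + u / (u - 1)); split.
  + simpl; fold u.
    replace (B * (- / x * prodR (map Rinv X) B + (1 - u) * dprodR (map Rinv X) B))
      with (- u * prodR (map Rinv X) B + (1 - u) * (B * dprodR (map Rinv X) B))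
      by (unfold u; ring).
    rewrite E1; field; lra.
  + simpl length; rewrite S_INR.
    assert (u / (u - 1) <= 2); [|lra].
    apply Rmult_le_reg_r with (u - 1); [lra|].
    replace (u / (u - 1) * (u - 1)) with u by (field; lra); lra.
Qed.

Lemma prodR_0 (l : list R) : prodR l 0 = 1.
Proof. induction l as [|t l IH]; simpl; [|rewrite IH]; ring. Qed.

Lemma prodR_root (l : list R) (t : R) : t <> 0 -> In t l -> prodR l (/ t) = 0.
Proof.
intros Ht; induction l as [|s l IH]; simpl; [tauto|].
intros [->|H]; [rewrite Rinv_r by exact Ht|rewrite IH by exact H]; ring.
Qed.

Lemma step_coef_head (b c : R) (l : list R) : b <> 0 -> step_coef b c l 0 = 1.
Proof. intros; unfold step_coef; rewrite coef_0; simpl; field; assumption. Qed.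

Lemma coef_from_root_points (Y : list R) (a : nat -> R) :
  incr 0 Y -> a O = 1 -> (forall k, (length Y < k)%nat -> a k = 0) ->
  (forall y, In y Y -> polyR a (length Y) y = 0) ->
  forall k, a k = coef (map Rinv Y) k.
Proof.
intros Hi H0 Hz Hr; apply coef_of_roots; auto.
- now apply incr_NoDup_inv.
- intros t Ht; apply in_map_iff in Ht; destruct Ht as (y & <- & Hy).
  apply Rinv_neq_0_compat; pose proof (incr_above _ _ _ Hi Hy); lra.
- now rewrite length_map.
- intros t Ht; apply in_map_iff in Ht; destruct Ht as (y & <- & Hy).
  rewrite Rinv_inv, length_map; auto.
Qed.

Lemma root_point_prodR (X : list R) (x : R) :
  incr 0 X -> In x X -> prodR (map Rinv X) x = 0.
Proof.
intros Hi Hx; pose proof (incr_above _ _ _ Hi Hx).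
rewrite <- (Rinv_inv x); apply prodR_root; [apply Rinv_neq_0_compat; lra|].
now apply in_map.
Qed.

Lemma list_upper_bound (X : list R) : exists M, 0 <= M /\ forall x, In x X -> 2 * x <= M.
Proof.
induction X as [|x X (M & HM & H)].
- exists 0; simpl; split; [lra|tauto].
- exists (Rmax (2 * x) M); split; [apply Rle_trans with (1 := HM), Rmax_r|].
  intros y [<-|Hy]; [apply Rmax_l|]; apply Rle_trans with (1 := H y Hy), Rmax_r.
Qed.

(** At a root of [p] the new polynomial equals [x p' / b], so its signs alternate along the
roots.  It is 1 at the origin and has the sign of [- p] far to the right, which yields
one root more than [p] has. *)
Lemma step_raises_degree (X : list R) (b c : R) : 0 < b -> 0 < c -> incr 0 X ->
  exists Y, length Y = S (length X) /\ incr 0 Y /\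
    forall k, step_coef b c (map Rinv X) k = coef (map Rinv Y) k.
Proof.
intros Hb Hc Hi.
set (l := map Rinv X); set (n := length X).
assert (Hl : length l = n) by apply length_map.
set (q := polyR (step_coef b c l) (S n)).
assert (Hq : forall x, q x = prodR l x + x * dprodR l x / b - c * x * prodR l x)
  by (intros x; apply step_coef_eval; [lra|rewrite Hl; auto]).
destruct (list_upper_bound X) as (M & HM0 & HM).
(* B exceeds twice every root and makes c * B larger than 1 + 2 * n / b, as log_derivative_bound requires. *)
set (B := M + 1 + (1 + 2 * INR n / b) / c).
assert (Hpos : 0 < 1 + 2 * INR n / b).
{ assert (0 <= 2 * INR n / b); [|lra].
  apply Rmult_le_pos; [pose proof (pos_INR n); lra|left; now apply Rinv_0_lt_compat]. }
assert (HB : M + 1 < B) by (unfold B; pose proof (Rdiv_lt_0_compat _ _ Hpos Hc); lra).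
assert (HX : forall x, In x X -> 0 < x /\ 2 * x <= B).
{ intros x Hx; split; [now apply (incr_above 0 x X)|]; pose proof (HM x Hx); lra. }
assert (HXB : forall x, In x X -> x < B) by (intros x Hx; destruct (HX x Hx); lra).
destruct (alternating_roots q (X ++ B :: nil) 0 1) as (Y & HY1 & HY2 & HY3 & _).
- apply polyR_continuity.
- apply incr_app; [exact Hi|lra|exact HXB].
- split; [rewrite Hq, prodR_0; lra|].
  apply (alternating_dprodR X 0 B q); [lra|exact Hi|exact HXB| |].
  + intros x Hx; exists (x / b); destruct (HX x Hx); split; [now apply Rdiv_lt_0_compat|].
    rewrite Hq; unfold l; rewrite root_point_prodR by assumption; field; lra.
  + destruct (log_derivative_bound X B HX) as (e & E1 & E2); fold l in E1.
    exists (c * B - 1 - e / b); split.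
    * assert (e / b <= 2 * INR n / b)
        by (apply Rmult_le_compat_r; [left; now apply Rinv_0_lt_compat|exact E2]).
      assert (c * B = c * (M + 1) + (1 + 2 * INR n / b)) by (unfold B; field; lra).
      assert (0 < c * (M + 1)) by (apply Rmult_lt_0_compat; lra).
      lra.
    * rewrite Hq, E1; fold l; field; lra.
- rewrite length_app in HY1; simpl in HY1; rewrite Nat.add_1_r in HY1.
  exists Y; split; [exact HY1|]; split; [exact HY2|].
  apply coef_from_root_points; auto.
  + apply step_coef_head; lra.
  + intros k Hk; fold n in HY1; unfold step_coef; destruct k as [|k]; [lia|].
    rewrite !coef_overflow by lia; ring.
  + rewrite HY1; exact HY3.
Qed.

(** Same sign pattern without the point at infinity: the intervals between the origin and
the successive roots already provide as many roots as the degree. *)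
Lemma step_keeps_degree (X : list R) (b : R) : 0 < b -> incr 0 X ->
  exists Y, length Y = length X /\ incr 0 Y /\
    (forall k, step_coef b 0 (map Rinv X) k = coef (map Rinv Y) k) /\
    match X, Y with x :: _, y :: _ => y < x | _, _ => True end.
Proof.
intros Hb Hi.
set (l := map Rinv X); set (n := length X).
assert (Hl : length l = n) by apply length_map.
set (q := polyR (step_coef b 0 l) n).
assert (Hq : forall x, q x = prodR l x + x * dprodR l x / b)
  by (intros x; apply step_coef_eval_0; [lra|rewrite Hl; auto]).
destruct (list_upper_bound X) as (M & HM0 & HM).
destruct (alternating_roots q X 0 1) as (Y & HY1 & HY2 & HY3 & HY4).
- apply polyR_continuity.
- exact Hi.
- split; [rewrite Hq, prodR_0; lra|].
  assert (HX : forall x, In x X -> 0 < x <= M).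
  { intros x Hx; pose proof (incr_above _ _ _ Hi Hx); pose proof (HM x Hx); lra. }
  (* alternating_dprodR needs a last point; the sign there is prescribed artificially and then dropped. *)
  set (f := fun x => if Rle_dec x M then q x else - prodR l x).
  apply alternating_ext with f.
  { intros x Hx; destruct (HX x Hx); unfold f; destruct (Rle_dec x M); [reflexivity|lra]. }
  apply alternating_app with ((M + 1) :: nil).
  apply (alternating_dprodR X 0 (M + 1) f); [lra|exact Hi| | |].
  + intros x Hx; destruct (HX x Hx); lra.
  + intros x Hx; destruct (HX x Hx) as [Hx1 Hx2].
    exists (x / b); split; [now apply Rdiv_lt_0_compat|].
    unfold f; destruct (Rle_dec x M); [|lra].
    rewrite Hq; unfold l; rewrite root_point_prodR by assumption; field; lra.
  + exists 1; split; [lra|]; unfold f; destruct (Rle_dec (M + 1) M); [lra|]; fold l; ring.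
- exists Y; split; [exact HY1|]; split; [exact HY2|]; split; [|exact HY4].
  apply coef_from_root_points; auto.
  + apply step_coef_head; lra.
  + intros k Hk; fold n in HY1; unfold step_coef; destruct k as [|k]; [lia|].
    rewrite coef_overflow by lia; ring.
  + rewrite HY1; exact HY3.
Qed.

(** * Laguerre approximants and symmetric functions *)

(** The absolute value of the coefficient of [x^k] in the Laguerre polynomial of degree [N]
and parameter [nu], normalized to be 1 at the origin.  It vanishes for [k > N] thanks to
the factor [N - k]. *)
Fixpoint laguerre_coef (nu : R) (N k : nat) : R :=
  match k with
  | O => 1
  | S j => laguerre_coef nu N j * (INR N - INR j) / ((INR j + 1) * (nu + 1 + INR j))
  end.

Lemma laguerre_coef_overflow (nu : R) (N k : nat) : (N < k)%nat -> laguerre_coef nu N k = 0.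
Proof.
intros H; induction H as [|k H IH]; simpl.
- unfold Rdiv; ring.
- rewrite IH; unfold Rdiv; ring.
Qed.

Lemma laguerre_pascal (nu : R) (N k : nat) : -1 < nu ->
  laguerre_coef nu (S N) (S k)
  = laguerre_coef nu N (S k) + laguerre_coef nu N k / (nu + 1 + INR k).
Proof.
intros Hnu.
assert (A : forall j, 0 < INR j + 1 /\ 0 < nu + 1 + INR j)
  by (intros j; pose proof (pos_INR j); lra).
induction k as [|k IH].
- unfold laguerre_coef; rewrite (S_INR N); simpl; field; lra.
- destruct (A k), (A (S k)); rewrite S_INR in *.
  change (laguerre_coef nu (S N) (S (S k))) with
    (laguerre_coef nu (S N) (S k) * (INR (S N) - INR (S k))
     / ((INR (S k) + 1) * (nu + 1 + INR (S k)))).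
  change (laguerre_coef nu N (S (S k))) with
    (laguerre_coef nu N (S k) * (INR N - INR (S k))
     / ((INR (S k) + 1) * (nu + 1 + INR (S k)))).
  rewrite IH; rewrite !S_INR.
  change (laguerre_coef nu N (S k)) with
    (laguerre_coef nu N k * (INR N - INR k) / ((INR k + 1) * (nu + 1 + INR k))).
  field; repeat split; lra.
Qed.

(** The relation [(N+1) L_(N+1) = (N+1+nu-x) L_N + x L_N'] between Laguerre polynomials. *)
Lemma laguerre_step (nu : R) (N k : nat) : -1 < nu ->
  laguerre_coef nu (S N) k
  = (1 + INR k / (nu + 1 + INR N)) * laguerre_coef nu N k
    + / (nu + 1 + INR N) * match k with O => 0 | S j => laguerre_coef nu N j end.
Proof.
intros Hnu; pose proof (pos_INR N); destruct k as [|k].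
- simpl; field; lra.
- rewrite laguerre_pascal by exact Hnu; rewrite S_INR; pose proof (pos_INR k).
  change (laguerre_coef nu N (S k)) with
    (laguerre_coef nu N k * (INR N - INR k) / ((INR k + 1) * (nu + 1 + INR k))).
  field; lra.
Qed.

Lemma laguerre_real_rooted (nu : R) (N : nat) : -1 < nu ->
  exists X, length X = N /\ incr 0 X /\
    forall k, coef (map Rinv X) k = (-1) ^ k * laguerre_coef nu N k.
Proof.
intros Hnu; induction N as [|N (X & HX1 & HX2 & HX3)].
- exists nil; simpl; repeat split; intros k; destruct k.
  + rewrite coef_0; simpl; ring.
  + rewrite coef_overflow, laguerre_coef_overflow by (simpl; lia); ring.
- assert (Hb : 0 < nu + 1 + INR N) by (pose proof (pos_INR N); lra).
  destruct (step_raises_degree X (nu + 1 + INR N) (/ (nu + 1 + INR N)))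
    as (Y & HY1 & HY2 & HY3); [exact Hb|now apply Rinv_0_lt_compat|exact HX2|].
  exists Y; split; [now rewrite HY1, HX1|]; split; [exact HY2|]; intros k.
  rewrite <- HY3, laguerre_step by exact Hnu; unfold step_coef.
  destruct k as [|k]; rewrite !HX3; [simpl; ring|].
  rewrite <- tech_pow_Rmult; ring.
Qed.

(** [1 / (4^k k! (nu+1)_k)]. *)
Fixpoint bessel_coef (nu : R) (k : nat) : R :=
  match k with
  | O => 1
  | S j => bessel_coef nu j / (4 * (INR j + 1) * (nu + 1 + INR j))
  end.

Definition approx_coef (nu : R) (N k : nat) : R := laguerre_coef nu N k / (4 * INR N) ^ k.

Lemma elem_sym_scale (s : R) (l : list R) (k : nat) :
  elem_sym k (map (fun t => t / s) l) = elem_sym k l / s ^ k.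
Proof.
revert k; induction l as [|t l IH]; intros k; simpl.
- destruct k; simpl; unfold Rdiv; [rewrite Rinv_1|]; ring.
- destruct k; rewrite !IH; simpl; [field; lra|].
  unfold Rdiv; rewrite Rinv_mult; ring.
Qed.

Lemma elem_sym_coef (l : list R) (k : nat) : elem_sym k l = (-1) ^ k * coef l k.
Proof.
unfold coef; rewrite <- Rmult_assoc, <- Rpow_mult_distr.
replace (-1 * -1) with 1 by ring; rewrite pow1; ring.
Qed.

Lemma incr_scale (s x : R) (X : list R) : 0 < s -> incr x X ->
  incr (s * x) (map (fun t => s * t) X).
Proof.
intros Hs; revert x; induction X as [|y X IH]; intros x; simpl; [tauto|].
intros [H1 H2]; split; [now apply Rmult_lt_compat_l|]; now apply IH.
Qed.

Lemma incr_square (x : R) (X : list R) : 0 <= x -> incr x X ->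
  incr (x * x) (map (fun t => t * t) X).
Proof.
revert x; induction X as [|y X IH]; intros x Hx; simpl; [tauto|].
intros [H1 H2]; split; [nra|]; apply IH; [lra|exact H2].
Qed.

Lemma elem_sym_step (l c : list R) (k : nat) :
  (forall k, step_coef 1 0 l k = coef c k) ->
  elem_sym k c = (INR k + 1) * elem_sym k l.
Proof.
intros H; rewrite !elem_sym_coef, <- H; unfold step_coef; field.
Qed.

Definition squares (l : list R) : list R := map (fun t => t * t) l.

(** Degree [N] model of the problem: [l] stands for the [t_i], [squares l] for the reciprocals
of the zeros of [w nu z / z], and [c1 :: c] for the reciprocals of the zeros of the
derivative of [w nu], with the largest one first. *)
Record approximant (nu : R) (N : nat) (l : list R) (c1 : R) (c : list R) : Prop := {
  approx_elem_sym : forall k, elem_sym k l = approx_coef nu N k;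
  approx_largest : forall t, In t c -> 0 < t <= c1;
  approx_largest_pos : 0 < c1;
  approx_largest_l : forall t, In t (squares l) -> 0 < t < c1;
  approx_derivative : forall k, elem_sym k (c1 :: c) = (INR k + 1) * elem_sym k (squares l)
}.

Lemma approximant_exists (nu : R) (N : nat) : -1 < nu -> (0 < N)%nat ->
  exists l c1 c, approximant nu N l c1 c.
Proof.
intros Hnu HN.
destruct (laguerre_real_rooted nu N Hnu) as (X & HX1 & HX2 & HX3).
assert (Hs : 0 < 4 * INR N) by (pose proof (lt_0_INR N HN); lra).
set (Z := map (fun t => 4 * INR N * t) X).
assert (HZ : incr 0 Z).
{ rewrite <- (Rmult_0_r (4 * INR N)); now apply incr_scale. }
set (Z2 := map (fun t => t * t) Z).
assert (HZ2 : incr 0 Z2).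
{ rewrite <- (Rmult_0_l 0); apply incr_square; [lra|exact HZ]. }
assert (El : squares (map Rinv Z) = map Rinv Z2).
{ unfold squares, Z2; rewrite !map_map; apply map_ext; intros t; now rewrite Rinv_mult. }
destruct (step_keeps_degree Z2 1 Rlt_0_1 HZ2) as (Y & HY1 & HY2 & HY3 & HY4).
assert (LZ : length Z2 = N) by (unfold Z2, Z; now rewrite !length_map).
destruct Y as [|y Y]; [simpl in HY1; lia|].
destruct Z2 as [|z Z2']; [simpl in LZ; lia|].
destruct HY2 as [Hy HY].
exists (map Rinv Z), (/ y), (map Rinv Y); split.
- intros k; unfold Z.
  replace (map Rinv (map (fun t => 4 * INR N * t) X))
    with (map (fun t => t / (4 * INR N)) (map Rinv X)).
  + rewrite elem_sym_scale, elem_sym_coef, HX3; unfold approx_coef.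
    rewrite <- Rmult_assoc, <- Rpow_mult_distr.
    replace (-1 * -1) with 1 by ring; rewrite pow1; unfold Rdiv; ring.
  + rewrite !map_map; apply map_ext; intros t; rewrite (Rinv_mult (4 * INR N)); unfold Rdiv; ring.
- intros t Ht; apply in_map_iff in Ht; destruct Ht as (u & <- & Hu).
  pose proof (incr_above _ _ _ HY Hu).
  split; [apply Rinv_0_lt_compat; lra|]; apply Rinv_le_contravar; lra.
- now apply Rinv_0_lt_compat.
- rewrite El; intros t Ht; apply in_map_iff in Ht; destruct Ht as (u & <- & Hu).
  assert (y < u).
  { destruct Hu as [<-|Hu]; [exact HY4|].
    destruct HZ2 as [_ HZ2]; pose proof (incr_above _ _ _ HZ2 Hu); lra. }
  split; [apply Rinv_0_lt_compat; lra|]; apply Rinv_lt_contravar; [|assumption]; nra.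
- intros k; rewrite El; apply (elem_sym_step _ (map Rinv (y :: Y))); exact HY3.
Qed.

(** Domination by the coefficients of the limit, uniform in [N]. *)
Lemma approx_coef_bounds (nu : R) (N k : nat) : -1 < nu -> (0 < N)%nat ->
  0 <= approx_coef nu N k <= bessel_coef nu k.
Proof.
intros Hnu HN.
assert (Hs : 0 < INR N) by now apply lt_0_INR.
unfold approx_coef; induction k as [|k IH]; simpl; [lra|].
pose proof (pos_INR k).
assert (D : 0 < 4 * (INR k + 1) * (nu + 1 + INR k))
  by (repeat apply Rmult_lt_0_compat; lra).
destruct (Compare_dec.le_lt_dec k N) as [L|L].
- replace (laguerre_coef nu N k * (INR N - INR k) / ((INR k + 1) * (nu + 1 + INR k))
    / (4 * INR N * (4 * INR N) ^ k))
  with (laguerre_coef nu N k / (4 * INR N) ^ k * (1 - INR k / INR N)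
    / (4 * (INR k + 1) * (nu + 1 + INR k))).
  2:{ field; repeat split; try lra; apply pow_nonzero; lra. }
  apply le_INR in L.
  assert (0 <= INR k / INR N <= 1).
  { split; [apply Rmult_le_pos; [lra|left; now apply Rinv_0_lt_compat]|].
    apply Rmult_le_reg_r with (INR N); [exact Hs|].
    replace (INR k / INR N * INR N) with (INR k) by (field; lra); lra. }
  assert (Di : 0 < / (4 * (INR k + 1) * (nu + 1 + INR k))) by now apply Rinv_0_lt_compat.
  split.
  + apply Rmult_le_pos; [apply Rmult_le_pos|]; lra.
  + unfold Rdiv; apply Rmult_le_compat_r; [lra|]; nra.
- rewrite laguerre_coef_overflow by exact L.
  unfold Rdiv; rewrite !Rmult_0_l; split; [lra|].
  apply Rmult_le_pos; [lra|left; now apply Rinv_0_lt_compat].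
Qed.

Lemma approx_coef_lim (nu : R) (k : nat) : -1 < nu ->
  is_lim_seq (fun N => approx_coef nu N k) (bessel_coef nu k).
Proof.
intros Hnu; induction k as [|k IH].
- apply is_lim_seq_ext with (fun _ => 1); [|apply is_lim_seq_const].
  intros N; unfold approx_coef; simpl; field.
- pose proof (pos_INR k).
  apply is_lim_seq_ext_loc with (fun N => approx_coef nu N k *
    ((1 - INR k * / INR N) * / (4 * (INR k + 1) * (nu + 1 + INR k)))).
  + exists 1%nat; intros N HN; assert (0 < INR N) by (apply lt_0_INR; lia).
    unfold approx_coef; simpl; field; repeat split; try lra; apply pow_nonzero; lra.
  + simpl; replace (bessel_coef nu k / (4 * (INR k + 1) * (nu + 1 + INR k))) with
      (bessel_coef nu k * ((1 - INR k * 0) * / (4 * (INR k + 1) * (nu + 1 + INR k))))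
      by (field; lra).
    apply is_lim_seq_mult'; [exact IH|].
    apply is_lim_seq_mult'; [|apply is_lim_seq_const].
    apply is_lim_seq_minus'; [apply is_lim_seq_const|].
    apply is_lim_seq_mult'; [apply is_lim_seq_const|].
    apply (is_lim_seq_inv INR p_infty); [apply is_lim_seq_INR|discriminate].
Qed.

Definition power_sum (k : nat) (l : list R) : R := fold_right (fun t s => t ^ k + s) 0 l.

Lemma elem_sym_0 (l : list R) : elem_sym 0 l = 1.
Proof. rewrite elem_sym_coef, coef_0; simpl; ring. Qed.

Ltac symmetric_induction l :=
  induction l as [|t l IH]; unfold squares in *; simpl in *; [ring|];
  rewrite ?IH, ?elem_sym_0 in *; try ring.

Lemma newton_1 (l : list R) : power_sum 1 l = elem_sym 1 l.
Proof. symmetric_induction l. Qed.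

Lemma newton_2 (l : list R) : power_sum 2 l = elem_sym 1 l ^ 2 - 2 * elem_sym 2 l.
Proof. symmetric_induction l. Qed.

Lemma newton_3 (l : list R) : power_sum 3 l =
  elem_sym 1 l ^ 3 - 3 * elem_sym 1 l * elem_sym 2 l + 3 * elem_sym 3 l.
Proof. symmetric_induction l. Qed.

Lemma newton_4 (l : list R) : power_sum 4 l =
  elem_sym 1 l ^ 4 - 4 * elem_sym 1 l ^ 2 * elem_sym 2 l + 2 * elem_sym 2 l ^ 2
  + 4 * elem_sym 1 l * elem_sym 3 l - 4 * elem_sym 4 l.
Proof. symmetric_induction l. Qed.

Lemma elem_sym_squares_1 (l : list R) :
  elem_sym 1 (squares l) = elem_sym 1 l ^ 2 - 2 * elem_sym 2 l.
Proof. symmetric_induction l. Qed.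

Lemma elem_sym_squares_2 (l : list R) : elem_sym 2 (squares l) =
  elem_sym 2 l ^ 2 - 2 * elem_sym 1 l * elem_sym 3 l + 2 * elem_sym 4 l.
Proof.
induction l as [|t l IH]; [simpl; ring|].
unfold squares in *; simpl in *; rewrite IH.
fold (squares l); rewrite elem_sym_squares_1, ?elem_sym_0; ring.
Qed.

Lemma elem_sym_squares_3 (l : list R) : elem_sym 3 (squares l) =
  elem_sym 3 l ^ 2 - 2 * elem_sym 2 l * elem_sym 4 l + 2 * elem_sym 1 l * elem_sym 5 l
  - 2 * elem_sym 6 l.
Proof.
induction l as [|t l IH]; [simpl; ring|].
unfold squares in *; simpl in *; rewrite IH.
fold (squares l); rewrite elem_sym_squares_2, ?elem_sym_0; ring.
Qed.

Lemma elem_sym_squares_4 (l : list R) : elem_sym 4 (squares l) =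
  elem_sym 4 l ^ 2 - 2 * elem_sym 3 l * elem_sym 5 l + 2 * elem_sym 2 l * elem_sym 6 l
  - 2 * elem_sym 1 l * elem_sym 7 l + 2 * elem_sym 8 l.
Proof.
induction l as [|t l IH]; [simpl; ring|].
unfold squares in *; simpl in *; rewrite IH.
fold (squares l); rewrite elem_sym_squares_3, ?elem_sym_0; ring.
Qed.

(** The polynomial version of [w nu z = z * g s * g (- s)] with [z = s^2]. *)
Lemma prodC_squares (l : list R) (s : C) :
  prodC (squares l) (s * s)%C = (prodC l s * prodC l (- s))%C.
Proof.
induction l as [|t l IH]; unfold squares in *; simpl in *; [ring|].
rewrite IH, RtoC_mult; ring.
Qed.

(** The chain rule for [prodC_squares]; it expresses the derivative in [z] by functions of [s]
whose limits are known. *)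
Lemma dprodC_squares (l : list R) (s : C) :
  (2 * s * dprodC (squares l) (s * s))%C
  = (dprodC l s * prodC l (- s) - prodC l s * dprodC l (- s))%C.
Proof.
induction l as [|t l IH]; [simpl; ring|].
pose proof (prodC_squares l s) as E.
unfold squares in *; simpl in *.
replace (2 * s * (- (t * t)%R * prodC (map (fun t => (t * t)%R) l) (s * s)
    + (1 - (t * t)%R * (s * s)) * dprodC (map (fun t => (t * t)%R) l) (s * s)))%C
  with (- (2 * s * (t * t)%R * prodC (map (fun t => (t * t)%R) l) (s * s))
    + (1 - (t * t)%R * (s * s)) * (2 * s * dprodC (map (fun t => (t * t)%R) l) (s * s)))%C by ring.
rewrite IH, E, RtoC_mult; ring.
Qed.

Lemma prodC_derivative (nu : R) (N : nat) (l : list R) (c1 : R) (c : list R) (z : C) :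
  approximant nu N l c1 c ->
  prodC (c1 :: c) z = (prodC (squares l) z + z * dprodC (squares l) z)%C.
Proof.
intros H; set (m := (length (c1 :: c) + length (squares l))%nat).
rewrite (prodC_expand _ _ m), (prodC_expand (squares l) _ m), (dprodC_expand _ _ m)
  by (unfold m; lia).
assert (E : forall k, coef (c1 :: c) k = coef (squares l) k + INR k * coef (squares l) k).
{ intros k; unfold coef; rewrite (approx_derivative _ _ _ _ _ H); ring. }
clearbody m; induction m as [|m IH]; cbn [polyC].
- rewrite E, RtoC_plus; reflexivity.
- rewrite E, IH, RtoC_plus; ring.
Qed.

(** * Estimates uniform in the degree *)

Arguments power_sum : simpl never.

Lemma exp_le (x y : R) : x <= y -> exp x <= exp y.
Proof. intros [H| ->]; [left; now apply exp_increasing|right; reflexivity]. Qed.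

Lemma power_sum_cons (k : nat) (t : R) (l : list R) :
  power_sum k (t :: l) = t ^ k + power_sum k l.
Proof. reflexivity. Qed.

Lemma power_sum_nonneg (k : nat) (l : list R) :
  (forall t, In t l -> 0 <= t) -> 0 <= power_sum k l.
Proof.
induction l as [|t l IH]; intros H; [unfold power_sum; simpl; lra|].
rewrite power_sum_cons; apply Rplus_le_le_0_compat.
- apply pow_le, H; now left.
- apply IH; intros u Hu; apply H; now right.
Qed.

Lemma Cmod_linear_factor (t Z : R) (z : C) : 0 <= t -> Cmod z <= Z ->
  Cmod (1 - t * z) <= exp (t * Z).
Proof.
intros Ht Hz; apply Rle_trans with (1 + t * Z); [|apply exp_ineq1_le].
unfold Cminus; apply Rle_trans with (1 := Cmod_triangle _ _).
rewrite Cmod_opp, Cmod_mult, Cmod_1, Cmod_R, Rabs_right by lra.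
assert (t * Cmod z <= t * Z) by now apply Rmult_le_compat_l. lra.
Qed.

(** The bounds in this lemma and the two that follow depend on the list only through the sum
of its entries, which stays bounded along the approximants. *)
Lemma prodC_bound (l : list R) (Z : R) (z : C) :
  (forall t, In t l -> 0 <= t) -> Cmod z <= Z ->
  Cmod (prodC l z) <= exp (power_sum 1 l * Z).
Proof.
intros Hl Hz; induction l as [|t l IH]; simpl.
- unfold power_sum; simpl; rewrite Cmod_1, Rmult_0_l, exp_0; lra.
- rewrite Cmod_mult, power_sum_cons, Rmult_plus_distr_r, exp_plus, pow_1.
  apply Rmult_le_compat; try apply Cmod_ge_0.
  + apply Cmod_linear_factor; auto; apply Hl; now left.
  + apply IH; intros u Hu; apply Hl; now right.
Qed.

Lemma prodC_lipschitz (l : list R) (Z : R) (z h : C) :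
  (forall t, In t l -> 0 <= t) -> Cmod z + Cmod h <= Z ->
  Cmod (prodC l (z + h) - prodC l z)
    <= Cmod h * (power_sum 1 l * exp (power_sum 1 l * Z)).
Proof.
intros Hl Hz; pose proof (Cmod_ge_0 h); pose proof (Cmod_ge_0 z).
induction l as [|t l IH].
- simpl; replace (1 - 1)%C with (RtoC 0) by ring; rewrite Cmod_0.
  unfold power_sum; simpl; nra.
- assert (Ht : 0 <= t) by (apply Hl; now left).
  assert (Hl' : forall u, In u l -> 0 <= u) by (intros u Hu; apply Hl; now right).
  specialize (IH Hl').
  pose proof (power_sum_nonneg 1 l Hl') as Hs.
  pose proof (prodC_bound l Z z Hl' ltac:(lra)) as Bp.
  assert (Hzh : Cmod (z + h) <= Z) by (pose proof (Cmod_triangle z h); lra).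
  pose proof (Cmod_linear_factor t Z (z + h) Ht Hzh) as Bf.
  rewrite power_sum_cons, pow_1.
  replace (exp ((t + power_sum 1 l) * Z)) with (exp (t * Z) * exp (power_sum 1 l * Z))
    by (rewrite <- exp_plus; f_equal; ring).
  assert (E1 : 1 <= exp (t * Z)) by (pose proof (exp_ineq1_le (t * Z)); nra).
  set (s := power_sum 1 l) in *; set (E := exp (s * Z)) in *; set (F := exp (t * Z)) in *.
  assert (HE : 0 < E) by apply exp_pos.
  replace (prodC (t :: l) (z + h) - prodC (t :: l) z)%C
    with ((1 - t * (z + h)) * (prodC l (z + h) - prodC l z) + - (t * h * prodC l z))%C
    by (simpl; ring).
  apply Rle_trans with (1 := Cmod_triangle _ _).
  rewrite Cmod_opp, !Cmod_mult, Cmod_R, (Rabs_right t) by lra.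
  apply Rle_trans with (F * (Cmod h * (s * E)) + t * Cmod h * E).
  + apply Rplus_le_compat.
    * apply Rmult_le_compat; auto using Cmod_ge_0.
    * apply Rmult_le_compat_l; [now apply Rmult_le_pos|exact Bp].
  + assert (0 <= t * Cmod h * E) by (repeat apply Rmult_le_pos; lra). nra.
Qed.

(** A remainder that is quadratic uniformly in the degree allows differentiation of the limit
without any theory of complex power series. *)
Lemma prodC_remainder (l : list R) (Z : R) (z h : C) :
  (forall t, In t l -> 0 <= t) -> Cmod z + Cmod h <= Z ->
  Cmod (prodC l (z + h) - prodC l z - h * dprodC l z)
    <= Cmod h ^ 2 * (power_sum 1 l ^ 2 * exp (power_sum 1 l * Z)).
Proof.
intros Hl Hz; pose proof (Cmod_ge_0 h); pose proof (Cmod_ge_0 z).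
induction l as [|t l IH].
- simpl; replace (1 - 1 - h * 0)%C with (RtoC 0) by ring; rewrite Cmod_0.
  unfold power_sum; simpl; nra.
- assert (Ht : 0 <= t) by (apply Hl; now left).
  assert (Hl' : forall u, In u l -> 0 <= u) by (intros u Hu; apply Hl; now right).
  specialize (IH Hl').
  pose proof (power_sum_nonneg 1 l Hl') as Hs.
  pose proof (prodC_lipschitz l Z z h Hl' Hz) as Bp.
  assert (Hzh : Cmod z <= Z) by lra.
  pose proof (Cmod_linear_factor t Z z Ht Hzh) as Bf.
  rewrite power_sum_cons, pow_1.
  replace (exp ((t + power_sum 1 l) * Z)) with (exp (t * Z) * exp (power_sum 1 l * Z))
    by (rewrite <- exp_plus; f_equal; ring).
  assert (E1 : 1 <= exp (t * Z)) by (pose proof (exp_ineq1_le (t * Z)); nra).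
  set (s := power_sum 1 l) in *; set (E := exp (s * Z)) in *; set (F := exp (t * Z)) in *.
  assert (HE : 0 < E) by apply exp_pos.
  replace (prodC (t :: l) (z + h) - prodC (t :: l) z - h * dprodC (t :: l) z)%C
    with ((1 - t * z) * (prodC l (z + h) - prodC l z - h * dprodC l z)
          + - (t * h * (prodC l (z + h) - prodC l z)))%C
    by (simpl; ring).
  apply Rle_trans with (1 := Cmod_triangle _ _).
  rewrite Cmod_opp, !Cmod_mult, Cmod_R, (Rabs_right t) by lra.
  apply Rle_trans with (F * (Cmod h ^ 2 * (s ^ 2 * E)) + t * Cmod h * (Cmod h * (s * E))).
  + apply Rplus_le_compat.
    * apply Rmult_le_compat; auto using Cmod_ge_0.
    * apply Rmult_le_compat_l; [now apply Rmult_le_pos|exact Bp].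
  + replace (Cmod h ^ 2 * ((t + s) ^ 2 * (F * E)))
      with (F * (Cmod h ^ 2 * (s ^ 2 * E)) + F * (t * Cmod h * (Cmod h * (s * E)))
        + (F * E * t * (t + s)) * Cmod h ^ 2) by ring.
    assert (0 <= t * Cmod h * (Cmod h * (s * E))) by (repeat apply Rmult_le_pos; lra).
    assert (0 <= F * E * t * (t + s) * Cmod h ^ 2)
      by (repeat apply Rmult_le_pos; try lra; apply pow_le; lra).
    nra.
Qed.

(** [- r p'(r) / p(r)] for the product [p] over [l]. *)
Fixpoint log_slope (l : list R) (r : R) : R :=
  match l with
  | nil => 0
  | t :: l' => t * r / (1 - t * r) + log_slope l' r
  end.

Lemma log_slope_spec (l : list R) (r : R) : (forall t, In t l -> t * r < 1) ->
  r * dprodR l r = - log_slope l r * prodR l r.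
Proof.
induction l as [|t l IH]; simpl; intros H; [ring|].
assert (t * r < 1) by (apply H; now left).
replace (r * (- t * prodR l r + (1 - t * r) * dprodR l r))
  with (- (t * r) * prodR l r + (1 - t * r) * (r * dprodR l r)) by ring.
rewrite IH by auto; field; lra.
Qed.

Lemma log_slope_nonneg (l : list R) (r : R) : 0 <= r ->
  (forall t, In t l -> 0 <= t /\ t * r < 1) -> 0 <= log_slope l r.
Proof.
intros Hr; induction l as [|t l IH]; simpl; intros H; [lra|].
destruct (H t (or_introl eq_refl)).
assert (0 <= t * r / (1 - t * r)).
{ apply Rmult_le_pos; [now apply Rmult_le_pos|left; apply Rinv_0_lt_compat; lra]. }
assert (0 <= log_slope l r) by auto. lra.
Qed.

Lemma prodR_le_1 (l : list R) (r : R) : 0 <= r ->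
  (forall t, In t l -> 0 <= t /\ t * r < 1) -> 0 < prodR l r <= 1.
Proof.
intros Hr; induction l as [|t l IH]; simpl; intros H; [lra|].
destruct (H t (or_introl eq_refl)).
assert (0 < prodR l r <= 1) by auto. assert (0 <= t * r) by now apply Rmult_le_pos.
split; [apply Rmult_lt_0_compat; lra|nra].
Qed.

Lemma prodC_lower_bound (l : list R) (z : C) :
  (forall t, In t l -> 0 <= t /\ t * Cmod z < 1) -> prodR l (Cmod z) <= Cmod (prodC l z).
Proof.
pose proof (Cmod_ge_0 z) as Hz.
induction l as [|t l IH]; simpl; intros H; [rewrite Cmod_1; lra|].
destruct (H t (or_introl eq_refl)) as [H1 H2]; rewrite Cmod_mult.
assert (0 < prodR l (Cmod z) <= 1) by (apply prodR_le_1; auto).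
apply Rmult_le_compat; [lra|lra| |apply IH; auto].
assert (E : Cmod 1 <= Cmod (1 - t * z) + Cmod (t * z)).
{ replace (RtoC 1) with ((1 - t * z) + t * z)%C at 1 by ring; apply Cmod_triangle. }
rewrite Cmod_1, Cmod_mult, Cmod_R, Rabs_right in E by lra; lra.
Qed.

Lemma Re_conj_self (z : C) : Re (z * Cconj z) = Cmod z ^ 2.
Proof.
destruct z as [x y]; unfold Cmod; rewrite pow2_sqrt; [simpl; ring|simpl; nra].
Qed.

Lemma Cmod_sq (z : C) : Cmod z ^ 2 = Re z ^ 2 + Im z ^ 2.
Proof. rewrite <- Re_conj_self; destruct z; simpl; ring. Qed.

(** Multiplied by [1 - s], the inequality becomes [(1 + s) Re u <= (1 + s) s]. *)
Lemma starlike_factor (s : R) (u : C) : Cmod u = s -> s < 1 ->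
  Re (u * Cconj (1 - u)) <= s / (1 - s) * Cmod (1 - u) ^ 2.
Proof.
intros Hu Hs.
assert (H0 : 0 <= s) by (rewrite <- Hu; apply Cmod_ge_0).
assert (Hr : Re u <= s).
{ rewrite <- Hu; apply Rle_trans with (Rabs (Re u)); [apply Rle_abs|].
  apply re_le_Cmod. }
apply Rmult_le_reg_l with (1 - s); [lra|].
replace ((1 - s) * (s / (1 - s) * Cmod (1 - u) ^ 2)) with (s * Cmod (1 - u) ^ 2)
  by (field; lra).
assert (E : Re u ^ 2 + Im u ^ 2 = s ^ 2) by (rewrite <- Cmod_sq, Hu; reflexivity).
rewrite Cmod_sq.
replace (Re (u * Cconj (1 - u))) with (Re u - (Re u ^ 2 + Im u ^ 2))
  by (destruct u; simpl; ring).
replace (Re (1 - u) ^ 2 + Im (1 - u) ^ 2) with (1 - 2 * Re u + (Re u ^ 2 + Im u ^ 2))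
  by (destruct u; simpl; ring).
rewrite E; nra.
Qed.

(** [Re (z p' / p)] is smallest at [z = |z|].  The quotient is multiplied by [|p|^2] so that no
division survives in the limit. *)
Lemma log_derivative_real_part (l : list R) (z : C) :
  (forall t, In t l -> 0 <= t /\ t * Cmod z < 1) ->
  - log_slope l (Cmod z) * Cmod (prodC l z) ^ 2
    <= Re (z * dprodC l z * Cconj (prodC l z)).
Proof.
induction l as [|t l IH]; intros H; [simpl; lra|].
destruct (H t (or_introl eq_refl)) as [H1 H2].
assert (Hu : Cmod (t * z) = t * Cmod z) by (rewrite Cmod_mult, Cmod_R, Rabs_right; lra).
pose proof (starlike_factor (t * Cmod z) (t * z) Hu H2) as F.
assert (IH' := IH (fun s Hs => H s (or_intror Hs))); clear IH.
cbn [prodC dprodC log_slope].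
set (f := (1 - t * z)%C) in *.
set (P := prodC l z) in *; set (D := dprodC l z) in *.
replace (z * (- t * P + f * D) * Cconj (f * P))%C
  with (- (t * z * Cconj f) * (P * Cconj P) + (f * Cconj f) * (z * D * Cconj P))%C
  by (rewrite Cmult_conj; ring).
assert (EP : (P * Cconj P)%C = RtoC (Cmod P ^ 2)).
{ rewrite <- Re_conj_self; destruct P; apply injective_projections; simpl; ring. }
assert (Ef : (f * Cconj f)%C = RtoC (Cmod f ^ 2)).
{ rewrite <- Re_conj_self; destruct f; apply injective_projections; simpl; ring. }
rewrite EP, Ef, Cmod_mult, Rpow_mult_distr.
replace (Re (- (t * z * Cconj f) * RtoC (Cmod P ^ 2) + RtoC (Cmod f ^ 2) * (z * D * Cconj P)))
  with (- Re (t * z * Cconj f) * Cmod P ^ 2 + Cmod f ^ 2 * Re (z * D * Cconj P))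
  by (generalize (t * z * Cconj f)%C (z * D * Cconj P)%C; intros [? ?] [? ?]; simpl; ring).
pose proof (pow2_ge_0 (Cmod P)); pose proof (pow2_ge_0 (Cmod f)).
nra.
Qed.

(** From [1 / (1 - u) = 1 + u / (1 - u) <= exp (u / (1 - u))] for each factor: a lower bound
independent of the degree. *)
Lemma prodR_exp_lower (l : list R) (r rho : R) : 0 <= r -> rho < 1 ->
  (forall t, In t l -> 0 <= t /\ t * r <= rho) ->
  exp (- (r / (1 - rho) * power_sum 1 l)) <= prodR l r.
Proof.
intros Hr Hrho; induction l as [|t l IH]; intros H.
- unfold power_sum; simpl; rewrite Rmult_0_r, Ropp_0, exp_0; lra.
- rewrite power_sum_cons, pow_1, Rmult_plus_distr_l, Ropp_plus_distr, exp_plus; simpl.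
  destruct (H t (or_introl eq_refl)) as [H1 H2].
  apply Rmult_le_compat; [left; apply exp_pos|left; apply exp_pos| |].
  2:{ apply IH; intros u Hu; apply H; now right. }
  assert (Hu : 0 <= t * r) by now apply Rmult_le_pos.
  assert (Hi : 0 < / (1 - rho)) by (apply Rinv_0_lt_compat; lra).
  apply Rle_trans with (/ (1 + r / (1 - rho) * t)).
  + rewrite exp_Ropp; apply Rinv_le_contravar; [|apply exp_ineq1_le].
    assert (0 <= r / (1 - rho) * t); [|lra].
    repeat apply Rmult_le_pos; lra.
  + replace (r / (1 - rho) * t) with (t * r / (1 - rho)) by (unfold Rdiv; ring).
    assert (0 <= t * r / (1 - rho)) by (apply Rmult_le_pos; lra).
    apply Rmult_le_reg_l with (1 + t * r / (1 - rho)); [lra|].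
    rewrite Rinv_r by lra.
    replace ((1 + t * r / (1 - rho)) * (1 - t * r))
      with (1 + t * r * ((rho - t * r) / (1 - rho))) by (field; lra).
    assert (0 <= t * r * ((rho - t * r) / (1 - rho))); [|lra].
    apply Rmult_le_pos; [exact Hu|apply Rmult_le_pos; lra].
Qed.

(** * Bessel series and the factorization of w *)

(** The unit complex number [exp (i t)]. *)
Definition cis (t : R) : C := (cos t, sin t).

Lemma cis_plus (a b : R) : cis (a + b) = (cis a * cis b)%C.
Proof.
unfold cis; rewrite cos_plus, sin_plus; apply injective_projections; simpl; ring.
Qed.

Lemma cis_mult_nat (a : R) (n : nat) : cis (INR n * a) = (cis a ^ n)%C.
Proof.
induction n as [|n IH].
- simpl; unfold cis; rewrite Rmult_0_l, cos_0, sin_0; reflexivity.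
- rewrite S_INR, Rmult_plus_distr_r, Rmult_1_l, Rplus_comm, cis_plus, IH; reflexivity.
Qed.

Lemma Cmod_cis (t : R) : Cmod (cis t) = 1.
Proof.
unfold Cmod, cis; simpl; rewrite !Rmult_1_r.
pose proof (sin2_cos2 t) as E; unfold Rsqr in E.
replace (cos t * cos t + sin t * sin t) with 1 by lra; apply sqrt_1.
Qed.

Lemma Carg_bounds (z : C) : - PI <= Carg z <= PI.
Proof.
unfold Carg; pose proof PI_RGT_0.
destruct (Rle_dec 0 (Im z)); pose proof (acos_bound (Re z / Cmod z)); lra.
Qed.

Lemma polar_form (z : C) : z <> RtoC 0 -> z = (Cmod z * cis (Carg z))%C.
Proof.
intros Hz.
assert (Hm : 0 < Cmod z) by now apply Cmod_gt_0.
set (q := Re z / Cmod z).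
assert (Sq : Re z ^ 2 + Im z ^ 2 = Cmod z ^ 2) by (symmetry; apply Cmod_sq).
assert (Hq : -1 <= q <= 1).
{ pose proof (re_le_Cmod z) as H.
  apply Rabs_le_between in H; unfold q; split.
  - apply Rmult_le_reg_r with (Cmod z); [exact Hm|].
    replace (Re z / Cmod z * Cmod z) with (Re z) by (field; lra); lra.
  - apply Rmult_le_reg_r with (Cmod z); [exact Hm|].
    replace (Re z / Cmod z * Cmod z) with (Re z) by (field; lra); lra. }
assert (Hs : sin (acos q) = Rabs (Im z) / Cmod z).
{ rewrite sin_acos by exact Hq.
  replace (1 - q²) with ((Rabs (Im z) / Cmod z)²).
  - apply sqrt_Rsqr, Rmult_le_pos; [apply Rabs_pos|left; now apply Rinv_0_lt_compat].
  - unfold Rsqr, q.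
    replace (Rabs (Im z) / Cmod z * (Rabs (Im z) / Cmod z))
      with (Rabs (Im z) ^ 2 / Cmod z ^ 2) by (field; lra).
    rewrite pow2_abs; replace (Im z ^ 2) with (Cmod z ^ 2 - Re z ^ 2) by lra; field; lra. }
assert (Hc : cos (acos q) = q) by now apply cos_acos.
unfold Carg, cis; fold q; destruct (Rle_dec 0 (Im z)) as [H|H].
- rewrite Hs, Hc, Rabs_right by lra; unfold q.
  destruct z as [x y]; simpl in *; apply injective_projections; simpl; field; lra.
- rewrite cos_neg, sin_neg, Hs, Hc, Rabs_left by lra; unfold q.
  destruct z as [x y]; simpl in *; apply injective_projections; simpl; field; lra.
Qed.

Lemma Cmod_polar (r t : R) : 0 < r -> Cmod (r * cis t) = r.
Proof. intros Hr; rewrite Cmod_mult, Cmod_cis, Cmod_R, Rabs_right; lra. Qed.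

(** The principal argument inverts the polar form only for angles above [- PI] and at
most [PI]; the angles to which it is applied are quarters of arguments. *)
Lemma Carg_polar (r t : R) : 0 < r -> - PI < t <= PI -> Carg (r * cis t) = t.
Proof.
intros Hr Ht; unfold Carg; rewrite Cmod_polar by exact Hr.
replace (Re (r * cis t)) with (r * cos t) by (simpl; ring).
replace (Im (r * cis t)) with (r * sin t) by (simpl; ring).
replace (r * cos t / r) with (cos t) by (field; lra).
destruct (Rle_dec 0 (r * sin t)) as [H|H].
- destruct (Rle_dec 0 t) as [H'|H']; [apply acos_cos; lra|].
  exfalso; assert (sin t < 0) by (apply sin_lt_0_var; lra); nra.
- destruct (Rle_dec 0 t) as [H'|H'].
  + exfalso; apply H; apply Rmult_le_pos; [lra|apply sin_ge_0; lra].
  + rewrite <- cos_neg, acos_cos; lra.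
Qed.

Lemma polar_nonzero (r t : R) : 0 < r -> (r * cis t)%C <> RtoC 0.
Proof. intros Hr E; pose proof (Cmod_polar r t Hr) as H; rewrite E, Cmod_0 in H; lra. Qed.

Lemma Cpowr_polar (r t a : R) : 0 < r -> - PI < t <= PI ->
  Cpowr (r * cis t) a = (Rpower r a * cis (a * t))%C.
Proof.
intros Hr Ht; unfold Cpowr.
destruct (Ceq_dec (r * cis t) (RtoC 0)) as [E|_]; [now apply polar_nonzero in E|].
rewrite Cmod_polar, Carg_polar by assumption.
apply injective_projections; simpl; ring.
Qed.

Lemma Cpowr_nonzero (z : C) (a : R) : z <> RtoC 0 ->
  Cpowr z a = (Rpower (Cmod z) a * cis (a * Carg z))%C.
Proof.
intros Hz; unfold Cpowr; destruct (Ceq_dec z (RtoC 0)); [tauto|].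
apply injective_projections; simpl; ring.
Qed.

Lemma bessel_coef_pos (nu : R) (k : nat) : -1 < nu -> 0 < bessel_coef nu k.
Proof.
intros Hnu; induction k as [|k IH]; simpl; [lra|]; pose proof (pos_INR k).
apply Rdiv_lt_0_compat; [exact IH|]; repeat apply Rmult_lt_0_compat; lra.
Qed.

Lemma bessel_coef_closed (nu : R) (k : nat) : -1 < nu ->
  bessel_coef nu k = / (4 ^ k * (INR (fact k) * pochhammer (nu + 1) k)) /\
  0 < pochhammer (nu + 1) k.
Proof.
intros Hnu; induction k as [|k [IH HP]].
- simpl; split; [field|lra].
- pose proof (pos_INR k).
  assert (P : 0 < pochhammer (nu + 1) (S k)) by (simpl; apply Rmult_lt_0_compat; lra).
  split; [|exact P].
  cbn [bessel_coef]; rewrite IH, fact_simpl, mult_INR, S_INR; simpl in P |- *.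
  pose proof (INR_fact_lt_0 k).
  field; repeat split; try lra; apply pow_nonzero; lra.
Qed.

Definition bessel_majorant (nu r : R) (k : nat) : R := (INR k + 1) * bessel_coef nu k * r ^ k.

Lemma bessel_majorant_summable (nu r : R) : -1 < nu -> 0 < r ->
  ex_series (bessel_majorant nu r).
Proof.
intros Hnu Hr.
assert (Pos : forall k, 0 < bessel_majorant nu r k).
{ intros k; pose proof (pos_INR k); unfold bessel_majorant.
  repeat apply Rmult_lt_0_compat; [lra|now apply bessel_coef_pos|now apply pow_lt]. }
apply ex_series_ext with (fun k => Rabs (bessel_majorant nu r k)).
{ intros k; apply Rabs_right; left; apply Pos. }
apply (ex_series_DAlembert _ 0); [lra|intros k; apply Rgt_not_eq, Pos|].
apply is_lim_seq_ext with
  (fun k => (1 + / (INR k + 1)) * (r / 4) * (/ (INR k + 1) * / (nu + 1 + INR k))).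
{ intros k; rewrite Rabs_right by (left; apply Rdiv_lt_0_compat; apply Pos).
  unfold bessel_majorant; cbn [bessel_coef]; rewrite S_INR; simpl pow.
  pose proof (pos_INR k); pose proof (bessel_coef_pos nu k Hnu).
  field; repeat split; try lra; apply pow_nonzero; lra. }
assert (L : forall c, is_lim_seq (fun k => / (c + INR k)) 0).
{ intros c; apply (is_lim_seq_inv (fun k => c + INR k) p_infty); [|discriminate].
  apply (is_lim_seq_plus (fun _ => c) INR c p_infty); [apply is_lim_seq_const|apply is_lim_seq_INR|].
  reflexivity. }
replace 0 with ((1 + 0) * (r / 4) * (0 * 0)) by ring.
assert (L1 : is_lim_seq (fun k => / (INR k + 1)) 0).
{ apply is_lim_seq_ext with (fun k => / (1 + INR k)); [|apply L].
  intros k; f_equal; ring. }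
apply is_lim_seq_mult'; [|apply is_lim_seq_mult'; [exact L1|apply L]].
apply is_lim_seq_mult'; [|apply is_lim_seq_const].
apply is_lim_seq_plus'; [apply is_lim_seq_const|exact L1].
Qed.

(** Dominated convergence for series. *)
Lemma tannery (u : nat -> nat -> R) (v M : nat -> R) :
  (forall N k, Rabs (u N k) <= M k) ->
  (forall k, is_lim_seq (fun N => u N k) (v k)) ->
  ex_series M ->
  is_lim_seq (fun N => Series (u N)) (Series v).
Proof.
intros Hu Hv HM.
assert (Hv' : forall k, Rabs (v k) <= M k).
{ intros k; pose proof (is_lim_seq_abs _ _ (Hv k)) as H.
  apply (is_lim_seq_le (fun N => Rabs (u N k)) (fun _ => M k) (Rabs (v k)) (M k));
    [intros; apply Hu|exact H|apply is_lim_seq_const]. }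
assert (Eu : forall a, (forall k, Rabs (a k) <= M k) -> forall n,
  Rabs (Series a - sum_f_R0 a n) <= Series M - sum_f_R0 M n).
{ intros a Ha n.
  assert (Xa : ex_series (fun k => Rabs (a k))).
  { apply (ex_series_le (K := R_AbsRing) (V := R_CompleteNormedModule) _ M); [|exact HM].
    intros k; unfold norm; simpl; unfold abs; simpl; rewrite Rabs_Rabsolu; apply Ha. }
  assert (Xa' : ex_series a) by now apply ex_series_Rabs.
  rewrite (Series_incr_n a (S n)), (Series_incr_n M (S n)) by (auto with arith).
  simpl pred.
  match goal with |- Rabs (?x + ?y - ?x) <= ?p + ?q - ?p =>
    replace (x + y - x) with y by ring; replace (p + q - p) with q by ring end.
  apply Rle_trans with (Series (fun k => Rabs (a (S n + k)%nat))).
  - apply Series_Rabs; now apply (ex_series_incr_n (fun k => Rabs (a k)) (S n)).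
  - apply Series_le; [|now apply (ex_series_incr_n M (S n))].
    intros k; split; [apply Rabs_pos|apply Ha]. }
apply is_lim_seq_spec; intros eps.
pose proof (cond_pos eps) as He.
assert (HT : exists n, Series M - sum_f_R0 M n < eps / 3).
{ pose proof (Series_correct M HM) as S.
  assert (S' : is_lim_seq (sum_f_R0 M) (Series M)).
  { apply is_lim_seq_ext with (sum_n M); [intros n; apply sum_n_Reals|exact S]. }
  apply is_lim_seq_spec in S'.
  assert (E3 : 0 < eps / 3) by lra.
  destruct (S' (mkposreal _ E3)) as [n Hn]; exists n.
  specialize (Hn n (le_n n)); simpl in Hn; apply Rabs_def2 in Hn; lra. }
destruct HT as [n Hn].
assert (HF : is_lim_seq (fun N => sum_f_R0 (u N) n) (sum_f_R0 v n)).
{ clear -Hv; induction n as [|n IH]; simpl; [apply Hv|].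
  apply is_lim_seq_plus'; [exact IH|apply Hv]. }
apply is_lim_seq_spec in HF.
assert (E3 : 0 < eps / 3) by lra.
destruct (HF (mkposreal _ E3)) as [N0 HN]; exists N0; intros N HN0.
specialize (HN N HN0); simpl in HN.
pose proof (Eu (u N) (Hu N) n) as T1; pose proof (Eu v Hv' n) as T2.
replace (Series (u N) - Series v)
  with ((Series (u N) - sum_f_R0 (u N) n) + (sum_f_R0 (u N) n - sum_f_R0 v n)
        - (Series v - sum_f_R0 v n)) by ring.
apply Rabs_def2 in HN; apply Rabs_le_between in T1; apply Rabs_le_between in T2.
apply Rabs_def1; lra.
Qed.

(** Convergence is taken by components, in accordance with the definition of [CSeries]. *)
Definition Clim (u : nat -> C) (l : C) : Prop :=
  is_lim_seq (fun n => Re (u n)) (Re l) /\ is_lim_seq (fun n => Im (u n)) (Im l).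

Lemma Clim_ext (u v : nat -> C) (l : C) : (forall n, u n = v n) -> Clim u l -> Clim v l.
Proof.
intros E [H1 H2]; split.
- apply is_lim_seq_ext with (2 := H1); intros n; now rewrite E.
- apply is_lim_seq_ext with (2 := H2); intros n; now rewrite E.
Qed.

Lemma Clim_const (c : C) : Clim (fun _ => c) c.
Proof. split; apply is_lim_seq_const. Qed.

Lemma Clim_plus (u v : nat -> C) (l m : C) :
  Clim u l -> Clim v m -> Clim (fun n => u n + v n)%C (l + m)%C.
Proof. intros [H1 H2] [H3 H4]; split; simpl; now apply is_lim_seq_plus'. Qed.

Lemma Clim_opp (u : nat -> C) (l : C) : Clim u l -> Clim (fun n => - u n)%C (- l)%C.
Proof. intros [H1 H2]; split; simpl; [apply (is_lim_seq_opp _ (Re l))|apply (is_lim_seq_opp _ (Im l))]; assumption. Qed.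

Lemma Clim_mult (u v : nat -> C) (l m : C) :
  Clim u l -> Clim v m -> Clim (fun n => u n * v n)%C (l * m)%C.
Proof.
intros [H1 H2] [H3 H4]; split; simpl.
- apply is_lim_seq_minus'; now apply is_lim_seq_mult'.
- apply is_lim_seq_plus'; now apply is_lim_seq_mult'.
Qed.

Lemma Clim_Cmod_sq (u : nat -> C) (l : C) :
  Clim u l -> is_lim_seq (fun n => Cmod (u n) ^ 2) (Cmod l ^ 2).
Proof.
intros [H1 H2]; rewrite Cmod_sq.
apply is_lim_seq_ext with (fun n => Re (u n) * Re (u n) + Im (u n) * Im (u n)).
{ intros n; rewrite Cmod_sq; ring. }
replace (Re l ^ 2 + Im l ^ 2) with (Re l * Re l + Im l * Im l) by ring.
apply is_lim_seq_plus'; now apply is_lim_seq_mult'.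
Qed.

Lemma Clim_Cmod (u : nat -> C) (l : C) :
  Clim u l -> is_lim_seq (fun n => Cmod (u n)) (Cmod l).
Proof.
intros H; apply Clim_Cmod_sq in H.
rewrite <- (sqrt_pow2 (Cmod l)) by apply Cmod_ge_0.
apply is_lim_seq_ext with (fun n => sqrt (Cmod (u n) ^ 2)).
{ intros n; apply sqrt_pow2, Cmod_ge_0. }
apply (is_lim_seq_continuous sqrt); [|exact H].
apply continuity_pt_sqrt, pow_le, Cmod_ge_0.
Qed.

Definition powerC (a : nat -> R) (z : C) : C := CSeries (fun k => a k * z ^ k)%C.

Lemma Re_scal (a : R) (z : C) : Re (a * z) = a * Re z.
Proof. destruct z; simpl; ring. Qed.

Lemma Im_scal (a : R) (z : C) : Im (a * z) = a * Im z.
Proof. destruct z; simpl; ring. Qed.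

Lemma Series_finite (a : nat -> R) (m : nat) :
  (forall k, (m < k)%nat -> a k = 0) -> Series a = sum_f_R0 a m.
Proof.
intros H.
assert (T : is_series (fun k => a (S m + k)%nat) 0).
{ apply is_series_ext with (fun _ => 0); [intros k; rewrite H; [reflexivity|lia]|].
  apply (filterlim_ext (fun _ => 0)); [|apply filterlim_const].
  intros n; induction n as [|n IH]; [now rewrite sum_O|].
  rewrite sum_Sn, <- IH; unfold plus; simpl; ring. }
rewrite (Series_incr_n a (S m)); [|lia|apply (ex_series_incr_n a (S m)); now exists 0].
rewrite (is_series_unique _ _ T); simpl pred; ring.
Qed.

Lemma polyC_powerC (a : nat -> R) (m : nat) (z : C) :
  (forall k, (m < k)%nat -> a k = 0) -> polyC a m z = powerC a z.
Proof.
intros H.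
assert (E : forall n, polyC a n z = (sum_f_R0 (fun k => a k * Re (z ^ k)) n,
                                     sum_f_R0 (fun k => a k * Im (z ^ k)) n)).
{ induction n as [|n IH].
  - apply injective_projections; simpl; ring.
  - cbn [polyC]; rewrite IH, !tech5; generalize (z ^ S n)%C; intros [x y].
    apply injective_projections; simpl; ring. }
rewrite E; unfold powerC, CSeries; f_equal; symmetry.
- rewrite <- Series_finite by (intros k Hk; rewrite H by exact Hk; ring).
  apply Series_ext; intros k; apply Re_scal.
- rewrite <- Series_finite by (intros k Hk; rewrite H by exact Hk; ring).
  apply Series_ext; intros k; apply Im_scal.
Qed.

Lemma im_le_Cmod (z : C) : Rabs (Im z) <= Cmod z.
Proof. apply Rle_trans with (2 := Rmax_Cmod z), Rmax_r. Qed.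

Lemma majorant_terms (nu : R) (z : C) (a : R) (k : nat) :
  Rabs a <= (INR k + 1) * bessel_coef nu k ->
  Rabs (Re (a * z ^ k)) <= bessel_majorant nu (Cmod z + 1) k /\
  Rabs (Im (a * z ^ k)) <= bessel_majorant nu (Cmod z + 1) k.
Proof.
intros Ha; pose proof (Cmod_ge_0 z) as Hz.
assert (B : Cmod (z ^ k) <= (Cmod z + 1) ^ k)
  by (rewrite Cmod_pow; apply pow_incr; lra).
rewrite Re_scal, Im_scal, !Rabs_mult; unfold bessel_majorant.
split; (apply Rmult_le_compat; [apply Rabs_pos|apply Rabs_pos|exact Ha|]);
  apply Rle_trans with (2 := B); [apply re_le_Cmod|apply im_le_Cmod].
Qed.

(** The factor [k + 1] in the domination leaves room for the series of [z g'(z)]. *)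
Lemma powerC_lim (nu : R) (a : nat -> nat -> R) (b : nat -> R) (z : C) : -1 < nu ->
  (forall N k, Rabs (a N k) <= (INR k + 1) * bessel_coef nu k) ->
  (forall k, is_lim_seq (fun N => a N k) (b k)) ->
  Clim (fun N => powerC (a N) z) (powerC b z).
Proof.
intros Hnu Ha Hb.
assert (HM : ex_series (bessel_majorant nu (Cmod z + 1)))
  by (apply bessel_majorant_summable; [exact Hnu|pose proof (Cmod_ge_0 z); lra]).
split; unfold powerC, CSeries; simpl.
- apply tannery with (3 := HM).
  + intros N k; apply (majorant_terms nu z (a N k) k (Ha N k)).
  + intros k; apply is_lim_seq_minus'; (apply is_lim_seq_mult'; [|apply is_lim_seq_const]);
      [apply Hb|apply is_lim_seq_const].
- apply tannery with (3 := HM).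
  + intros N k; apply (majorant_terms nu z (a N k) k (Ha N k)).
  + intros k; apply is_lim_seq_plus'; (apply is_lim_seq_mult'; [|apply is_lim_seq_const]);
      [apply Hb|apply is_lim_seq_const].
Qed.

Lemma CSeries_scal (c : C) (u : nat -> C) :
  ex_series (fun n => Re (u n)) -> ex_series (fun n => Im (u n)) ->
  CSeries (fun n => c * u n)%C = (c * CSeries u)%C.
Proof.
intros H1 H2; unfold CSeries; destruct c as [x y]; apply injective_projections; simpl.
- rewrite Series_minus, !Series_scal_l; [reflexivity| |];
    now apply (ex_series_scal_l (K := R_AbsRing) (V := R_NormedModule)).
- rewrite Series_plus, !Series_scal_l; [reflexivity| |];
    now apply (ex_series_scal_l (K := R_AbsRing) (V := R_NormedModule)).
Qed.

Definition signed_bessel_coef (nu : R) (k : nat) : R := (-1) ^ k * bessel_coef nu k.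

Definition bessel_series (nu : R) (z : C) : C := powerC (signed_bessel_coef nu) z.

Lemma bessel_series_summable (nu : R) (z : C) : -1 < nu ->
  ex_series (fun k => Re (signed_bessel_coef nu k * z ^ k)) /\
  ex_series (fun k => Im (signed_bessel_coef nu k * z ^ k)).
Proof.
intros Hnu.
assert (HM : ex_series (bessel_majorant nu (Cmod z + 1)))
  by (apply bessel_majorant_summable; [exact Hnu|pose proof (Cmod_ge_0 z); lra]).
assert (A : forall k, Rabs (signed_bessel_coef nu k) <= (INR k + 1) * bessel_coef nu k).
{ intros k; unfold signed_bessel_coef; rewrite Rabs_mult, pow_1_abs.
  pose proof (bessel_coef_pos nu k Hnu); rewrite Rabs_right by lra.
  pose proof (pos_INR k); nra. }
split; (apply (ex_series_le (K := R_AbsRing) (V := R_CompleteNormedModule) _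
  (bessel_majorant nu (Cmod z + 1))); [|exact HM]);
  intros k; apply (majorant_terms nu z _ k (A k)).
Qed.

(** All terms share the factor [(r cis t)^nu / Gamma (nu + 1)]; what remains is a power series
in the square of the argument, with opposite signs for [J] and [I]. *)
Lemma Bessel_polar (nu r t : R) : -1 < nu -> 0 < r -> - PI < t <= PI ->
  let c := (/ Gamma (nu + 1) * (Rpower r nu * cis (nu * t)))%C in
  let s := (4 * ((r * r)%R * cis (2 * t)))%C in
  BesselJ nu (2 * (r * cis t))%C = (c * bessel_series nu s)%C /\
  BesselI nu (2 * (r * cis t))%C = (c * bessel_series nu (- s))%C.
Proof.
intros Hnu Hr Ht c s.
destruct (Gamma_is_integral (nu + 1) ltac:(lra)) as [_ HG].
assert (Term : forall n, (RtoC (1 / (INR (fact n) * Gamma (nu + INR n + 1)))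
   * Cpowr (2 * (r * cis t) / RtoC 2) (nu + 2 * INR n))%C
   = (c * (bessel_coef nu n * s ^ n))%C).
{ intros n.
  replace (2 * (r * cis t) / RtoC 2)%C with (r * cis t)%C.
  2:{ field; intros E; apply RtoC_inj in E; lra. }
  rewrite Cpowr_polar by assumption.
  replace (nu + INR n + 1) with (nu + 1 + INR n) by ring.
  rewrite Gamma_shift by lra.
  destruct (bessel_coef_closed nu n Hnu) as [-> HP].
  replace ((nu + 2 * INR n) * t) with (nu * t + INR n * (2 * t)) by ring.
  rewrite cis_plus, cis_mult_nat, Rpower_plus.
  replace (2 * INR n) with (INR (2 * n)) by (rewrite mult_INR; simpl; ring).
  rewrite Rpower_pow by exact Hr.
  rewrite pow_mult; replace (r ^ 2) with (r * r) by ring.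
  unfold s, c; rewrite !Cpow_mult_l, <- !RtoC_pow.
  pose proof (INR_fact_lt_0 n).
  rewrite <- RtoC_inv by lra.
  generalize (cis (2 * t) ^ n)%C (cis (nu * t)); intros e1 e2.
  replace (1 / (INR (fact n) * (Gamma (nu + 1) * pochhammer (nu + 1) n)))
    with (/ Gamma (nu + 1) * (/ (4 ^ n * (INR (fact n) * pochhammer (nu + 1) n)) * 4 ^ n)).
  2:{ field; repeat split; try lra; apply pow_nonzero; lra. }
  rewrite !RtoC_mult; ring. }
split.
- unfold BesselJ, bessel_series, powerC.
  destruct (bessel_series_summable nu s Hnu) as [S1 S2].
  rewrite <- CSeries_scal by assumption.
  unfold CSeries; f_equal; apply Series_ext; intros n; f_equal;
  (replace ((-1) ^ n / (INR (fact n) * Gamma (nu + INR n + 1)))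
    with ((-1) ^ n * (1 / (INR (fact n) * Gamma (nu + INR n + 1)))) by (unfold Rdiv; ring));
  rewrite RtoC_mult, <- Cmult_assoc, Term; unfold signed_bessel_coef; rewrite RtoC_mult; ring.
- unfold BesselI, bessel_series, powerC.
  destruct (bessel_series_summable nu (- s) Hnu) as [S1 S2].
  rewrite <- CSeries_scal by assumption.
  unfold CSeries; f_equal; apply Series_ext; intros n; f_equal;
  rewrite Term; unfold signed_bessel_coef;
  (replace (- s)%C with (RtoC (-1) * s)%C by (apply injective_projections; simpl; ring));
  rewrite Cpow_mult_l, <- RtoC_pow, RtoC_mult;
  (replace (RtoC ((-1) ^ n) * bessel_coef nu n * (RtoC ((-1) ^ n) * s ^ n))%C
    with (RtoC ((-1) ^ n * (-1) ^ n) * (bessel_coef nu n * s ^ n))%C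
    by (rewrite RtoC_mult; ring));
  rewrite <- Rpow_mult_distr; (replace (-1 * -1) with 1 by ring);
  rewrite pow1; ring.
Qed.

(** The factors [z^(1/4)] to the power [2 nu] and [z^(- nu / 2)] cancel because the argument
of the principal fourth root is exactly a quarter of that of [z]. *)
Lemma w_factorization (nu : R) (z : C) : -1 < nu -> z <> RtoC 0 ->
  exists s, (s * s)%C = z /\
    w nu z = (z * (bessel_series nu s * bessel_series nu (- s)))%C.
Proof.
intros Hnu Hz.
assert (Hm : 0 < Cmod z) by now apply Cmod_gt_0.
set (m := Cmod z) in *; set (t := Carg z).
pose proof (Carg_bounds z) as Bt; fold t in Bt.
pose proof PI_RGT_0 as HPI.
set (r := Rpower m (1 / 4) / 2).
assert (Hq : 0 < Rpower m (1 / 4)) by apply exp_pos.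
assert (Hr : 0 < r) by (unfold r; lra).
destruct (Gamma_is_integral (nu + 1) ltac:(lra)) as [_ HG].
assert (Er : 4 * (r * r) = Rpower m (1 / 2)).
{ unfold r; replace (4 * (Rpower m (1 / 4) / 2 * (Rpower m (1 / 4) / 2)))
    with (Rpower m (1 / 4) * Rpower m (1 / 4)) by field.
  rewrite <- Rpower_plus; f_equal; field. }
assert (Eq : Cpowr z (1 / 4) = (2 * (r * cis (t / 4)))%C).
{ rewrite Cpowr_nonzero by exact Hz; fold m t.
  replace (1 / 4 * t) with (t / 4) by field.
  rewrite Cmult_assoc, <- RtoC_mult; do 2 f_equal; unfold r; field. }
destruct (Bessel_polar nu r (t / 4) Hnu Hr ltac:(lra)) as [EJ EI].
exists (4 * ((r * r)%R * cis (2 * (t / 4))))%C; split.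
- replace (4 * ((r * r)%R * cis (2 * (t / 4))))%C with (Rpower m (1 / 2) * cis (t / 2))%C.
  2:{ rewrite <- Er; replace (2 * (t / 4)) with (t / 2) by field; rewrite !RtoC_mult; ring. }
  replace (Rpower m (1 / 2) * cis (t / 2) * (Rpower m (1 / 2) * cis (t / 2)))%C
    with (RtoC (Rpower m (1 / 2) * Rpower m (1 / 2)) * (cis (t / 2) * cis (t / 2)))%C
    by (rewrite RtoC_mult; ring).
  rewrite <- cis_plus, <- Rpower_plus.
  replace (t / 2 + t / 2) with t by field; replace (1 / 2 + 1 / 2) with 1 by field.
  rewrite Rpower_1 by exact Hm; symmetry; now apply polar_form.
- unfold w, JI_product; rewrite Eq, EJ, EI.
  rewrite Cpowr_nonzero by exact Hz; fold m t.
  generalize (bessel_series nu (4 * ((r * r)%R * cis (2 * (t / 4)))))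
    (bessel_series nu (- (4 * ((r * r)%R * cis (2 * (t / 4)))))); intros g1 g2.
  rewrite (polar_form z Hz) at 1; fold m t.
  replace (cis t) with (cis ((- nu / 2 + 1) * t) * (cis (nu * (t / 4)) * cis (nu * (t / 4))))%C
    by (rewrite <- !cis_plus; f_equal; field).
  replace (RtoC m) with (RtoC (Rpower 2 (2 * nu) * Rpower m (- nu / 2 + 1)
    * (Rpower r nu * Rpower r nu))).
  + rewrite !RtoC_mult.
    rewrite RtoC_pow; simpl Cpow.
    field; intros E; apply RtoC_inj in E; lra.
  + f_equal; rewrite <- (Rpower_plus nu nu r).
    assert (Er' : r = Rpower m (1 / 4) * Rpower 2 (-1)).
    { unfold r; replace (-1) with (- (1)) by ring.
      rewrite Rpower_Ropp, Rpower_1 by lra; reflexivity. }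
    rewrite Er', <- Rpower_mult_distr by apply exp_pos.
    rewrite !Rpower_mult.
    replace (Rpower 2 (2 * nu) * Rpower m (- nu / 2 + 1)
      * (Rpower m (1 / 4 * (nu + nu)) * Rpower 2 (-1 * (nu + nu))))
      with ((Rpower 2 (2 * nu) * Rpower 2 (-1 * (nu + nu)))
        * (Rpower m (- nu / 2 + 1) * Rpower m (1 / 4 * (nu + nu)))) by ring.
    rewrite <- !Rpower_plus.
    replace (2 * nu + -1 * (nu + nu)) with 0 by ring.
    replace (- nu / 2 + 1 + 1 / 4 * (nu + nu)) with 1 by field.
    rewrite Rpower_O, Rpower_1 by lra; ring.
Qed.

(** * Passage to the limit *)

Definition approximants (nu : R) (l : nat -> list R) (c1 : nat -> R) (c : nat -> list R) : Prop :=
  forall N, approximant nu (S N) (l N) (c1 N) (c N).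

Lemma approximants_exist (nu : R) : -1 < nu -> exists l c1 c, approximants nu l c1 c.
Proof.
intros Hnu.
assert (H : forall N, exists p : list R * R * list R,
  approximant nu (S N) (fst (fst p)) (snd (fst p)) (snd p)).
{ intros N; destruct (approximant_exists nu (S N) Hnu) as (l & c1 & c & H); [lia|].
  now exists (l, c1, c). }
set (p := fun N => proj1_sig (constructive_indefinite_description _ (H N))).
exists (fun N => fst (fst (p N))), (fun N => snd (fst (p N))), (fun N => snd (p N)).
intros N; exact (proj2_sig (constructive_indefinite_description _ (H N))).
Qed.

Lemma approximant_lim (nu : R) l c1 c (k : nat) : -1 < nu -> approximants nu l c1 c ->
  is_lim_seq (fun N => elem_sym k (l N)) (bessel_coef nu k).
Proof.
intros Hnu H.
apply is_lim_seq_ext with (fun N => approx_coef nu (S N) k).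
{ intros N; symmetry; apply (approx_elem_sym _ _ _ _ _ (H N)). }
apply (is_lim_seq_incr_1 (fun N => approx_coef nu N k)); now apply approx_coef_lim.
Qed.

Lemma approximant_prodC_lim (nu : R) l c1 c (s : C) : -1 < nu -> approximants nu l c1 c ->
  Clim (fun N => prodC (l N) s) (bessel_series nu s).
Proof.
intros Hnu H.
apply Clim_ext with (fun N => powerC (coef (l N)) s).
{ intros N; rewrite (prodC_expand _ _ (length (l N))) by lia.
  symmetry; apply polyC_powerC; intros k Hk; now apply coef_overflow. }
apply (powerC_lim nu); [exact Hnu| |].
- intros N k; unfold coef; rewrite Rabs_mult, pow_1_abs, (approx_elem_sym _ _ _ _ _ (H N)).
  destruct (approx_coef_bounds nu (S N) k Hnu) as [B1 B2]; [lia|].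
  rewrite Rabs_right by lra; pose proof (pos_INR k); nra.
- intros k; apply is_lim_seq_mult'; [apply is_lim_seq_const|].
  now apply approximant_lim with c1 c.
Qed.

Lemma approximant_dprodC_lim (nu : R) l c1 c (s : C) : -1 < nu -> approximants nu l c1 c ->
  exists d, Clim (fun N => s * dprodC (l N) s)%C d.
Proof.
intros Hnu H; exists (powerC (fun k => INR k * signed_bessel_coef nu k) s).
apply Clim_ext with (fun N => powerC (fun k => INR k * coef (l N) k) s).
{ intros N; rewrite (dprodC_expand _ _ (length (l N))) by lia.
  symmetry; apply polyC_powerC; intros k Hk; rewrite coef_overflow by exact Hk; ring. }
apply (powerC_lim nu); [exact Hnu| |].
- intros N k; unfold coef; rewrite !Rabs_mult, pow_1_abs, (approx_elem_sym _ _ _ _ _ (H N)).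
  destruct (approx_coef_bounds nu (S N) k Hnu) as [B1 B2]; [lia|].
  rewrite !Rabs_right by (try apply Rle_ge, pos_INR; lra); pose proof (pos_INR k); nra.
- intros k; apply is_lim_seq_mult'; [apply is_lim_seq_const|].
  apply is_lim_seq_mult'; [apply is_lim_seq_const|].
  now apply approximant_lim with c1 c.
Qed.

(** The limit of the derivatives is obtained through [dprodC_squares] from the limits of
[s * dprodC l s] at [s] and [- s], where [s^2 = z]. *)
Lemma w_limit (nu : R) l c1 c (z : C) : -1 < nu -> approximants nu l c1 c -> z <> RtoC 0 ->
  exists F D, w nu z = (z * F)%C /\
    Clim (fun N => prodC (squares (l N)) z) F /\
    Clim (fun N => prodC (c1 N :: c N) z) D.
Proof.
intros Hnu H Hz.
destruct (w_factorization nu z Hnu Hz) as (s & Es & Ew).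
destruct (approximant_dprodC_lim nu l c1 c s Hnu H) as [d1 H1].
destruct (approximant_dprodC_lim nu l c1 c (- s)%C Hnu H) as [d2 H2].
pose proof (approximant_prodC_lim nu l c1 c s Hnu H) as G1.
pose proof (approximant_prodC_lim nu l c1 c (- s)%C Hnu H) as G2.
assert (HF : Clim (fun N => prodC (squares (l N)) z)
  (bessel_series nu s * bessel_series nu (- s))%C).
{ apply Clim_ext with (fun N => prodC (l N) s * prodC (l N) (- s))%C.
  - intros N; rewrite <- Es; symmetry; apply prodC_squares.
  - now apply Clim_mult. }
exists (bessel_series nu s * bessel_series nu (- s))%C.
exists (bessel_series nu s * bessel_series nu (- s)
  + RtoC (1 / 2) * (d1 * bessel_series nu (- s) + bessel_series nu s * d2))%C.
split; [exact Ew|]; split; [exact HF|].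
apply Clim_ext with (fun N => prodC (squares (l N)) z
  + RtoC (1 / 2) * ((s * dprodC (l N) s) * prodC (l N) (- s)
    + prodC (l N) s * (- s * dprodC (l N) (- s))))%C.
- intros N; rewrite (prodC_derivative _ _ _ _ _ z (H N)); f_equal.
  rewrite <- Es.
  replace (s * dprodC (l N) s * prodC (l N) (- s)
      + prodC (l N) s * (- s * dprodC (l N) (- s)))%C
    with (s * (dprodC (l N) s * prodC (l N) (- s)
      - prodC (l N) s * dprodC (l N) (- s)))%C by ring.
  rewrite <- dprodC_squares.
  replace (RtoC (1 / 2) * (s * (2 * s * dprodC (squares (l N)) (s * s))))%C
    with (RtoC (1 / 2) * RtoC 2 * (s * s * dprodC (squares (l N)) (s * s)))%C by ring.
  rewrite <- RtoC_mult; replace (1 / 2 * 2) with 1 by field; ring.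
- apply Clim_plus; [exact HF|]; apply Clim_mult; [apply Clim_const|].
  apply Clim_plus; now apply Clim_mult.
Qed.

Lemma eventually_le (u : nat -> R) (l b : R) : is_lim_seq u l -> l < b ->
  exists N0, forall N, (N0 <= N)%nat -> u N <= b.
Proof.
intros H Hb; apply is_lim_seq_spec in H.
assert (E : 0 < b - l) by lra.
destruct (H (mkposreal _ E)) as [N0 HN]; exists N0; intros N HN0.
specialize (HN N HN0); simpl in HN; apply Rabs_def2 in HN; lra.
Qed.

Lemma eventually_ge (u : nat -> R) (l b : R) : is_lim_seq u l -> b < l ->
  exists N0, forall N, (N0 <= N)%nat -> b <= u N.
Proof.
intros H Hb; apply is_lim_seq_spec in H.
assert (E : 0 < l - b) by lra.
destruct (H (mkposreal _ E)) as [N0 HN]; exists N0; intros N HN0.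
specialize (HN N HN0); simpl in HN; apply Rabs_def2 in HN; lra.
Qed.

Lemma lim_le_eventually (u : nat -> R) (l b : R) : is_lim_seq u l ->
  (exists N0, forall N, (N0 <= N)%nat -> u N <= b) -> l <= b.
Proof.
intros H [N0 HN].
apply (is_lim_seq_le_loc u (fun _ => b) l b); [|exact H|apply is_lim_seq_const].
now exists N0.
Qed.

Lemma approximant_positive (nu : R) l c1 c (N : nat) (t : R) : approximants nu l c1 c ->
  In t (c1 N :: c N) -> 0 < t <= c1 N.
Proof.
intros H [<-|Ht].
- pose proof (approx_largest_pos _ _ _ _ _ (H N)); lra.
- now apply (approx_largest _ _ _ _ _ (H N)).
Qed.

Lemma squares_sum_bounded (nu : R) l c1 c : -1 < nu -> approximants nu l c1 c ->
  exists S N0, 0 < S /\ forall N, (N0 <= N)%nat ->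
    power_sum 1 (squares (l N)) <= S /\ power_sum 1 (c1 N :: c N) <= S.
Proof.
intros Hnu H.
assert (L : is_lim_seq (fun N => 2 * power_sum 1 (squares (l N)))
  (2 * (bessel_coef nu 1 * bessel_coef nu 1 - 2 * bessel_coef nu 2))).
{ apply is_lim_seq_ext with
    (fun N => 2 * (elem_sym 1 (l N) * elem_sym 1 (l N) - 2 * elem_sym 2 (l N))).
  - intros N; rewrite newton_1, elem_sym_squares_1; ring.
  - apply is_lim_seq_mult'; [apply is_lim_seq_const|].
    apply is_lim_seq_minus'; apply is_lim_seq_mult';
      try apply is_lim_seq_const; now apply approximant_lim with c1 c. }
set (S := Rmax 0 (2 * (bessel_coef nu 1 * bessel_coef nu 1 - 2 * bessel_coef nu 2)) + 1).
pose proof (Rmax_l 0 (2 * (bessel_coef nu 1 * bessel_coef nu 1 - 2 * bessel_coef nu 2))).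
pose proof (Rmax_r 0 (2 * (bessel_coef nu 1 * bessel_coef nu 1 - 2 * bessel_coef nu 2))).
destruct (eventually_le _ _ S L) as [N0 HN]; [unfold S; lra|].
exists S, N0; split; [unfold S; lra|]; intros N HN0; specialize (HN N HN0); simpl in HN.
assert (0 <= power_sum 1 (squares (l N))).
{ apply power_sum_nonneg; intros t Ht.
  pose proof (approx_largest_l _ _ _ _ _ (H N) t Ht); lra. }
split; [lra|].
rewrite (newton_1 (c1 N :: c N)), (approx_derivative _ _ _ _ _ (H N)), <- newton_1; simpl INR; lra.
Qed.

Lemma is_derive_C_intro (f : C -> C) (z d : C) (K delta : R) : 0 < delta ->
  (forall h, Cmod h < delta -> Cmod (f (z + h) - f z - h * d)%C <= K * Cmod h ^ 2) ->
  is_derive (K := C_AbsRing) (V := C_NormedModule) f z d.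
Proof.
intros Hd H; split.
- apply (is_linear_scal_l (K := C_AbsRing) (V := C_NormedModule)).
- intros x Hx; apply (is_filter_lim_locally_unique (K := C_AbsRing) (V := AbsRing_NormedModule C_AbsRing)) in Hx; subst x.
  intros eps; pose proof (cond_pos eps) as He.
  set (K' := Rmax K 1).
  assert (HK : K <= K') by apply Rmax_l. assert (HK1 : 1 <= K') by apply Rmax_r.
  assert (Hm : 0 < Rmin delta (eps / K')).
  { apply Rmin_glb_lt; [exact Hd|apply Rdiv_lt_0_compat; lra]. }
  exists (mkposreal _ Hm); intros y Hy.
  unfold ball in Hy; simpl in Hy; unfold AbsRing_ball, abs in Hy; simpl in Hy.
  set (h := (y - z)%C).
  assert (Hh : Cmod h < Rmin delta (eps / K')) by exact Hy.
  assert (Hh1 : Cmod h < delta) by (apply Rlt_le_trans with (1 := Hh), Rmin_l).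
  assert (Hh2 : Cmod h < eps / K') by (apply Rlt_le_trans with (1 := Hh), Rmin_r).
  assert (Ey : @eq C (z + h)%C y) by (unfold h; ring).
  specialize (H h Hh1); rewrite Ey in H.
  change (Cmod (f y - f z - h * d)%C <= eps * Cmod h).
  apply Rle_trans with (1 := H); pose proof (Cmod_ge_0 h).
  assert (Cmod h * K' <= eps).
  { apply Rmult_le_reg_r with (/ K'); [apply Rinv_0_lt_compat; lra|].
    replace (Cmod h * K' * / K') with (Cmod h) by (field; lra); unfold Rdiv in Hh2; lra. }
  assert (K * Cmod h <= eps) by nra. nra.
Qed.

(** [is_derive_C_intro] and this lemma translate between complex differentiability and explicit
estimates in [Cmod]. *)
Lemma is_derive_C_elim (f : C -> C) (z d : C) (eps : R) : 0 < eps ->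
  is_derive (K := C_AbsRing) (V := C_NormedModule) f z d ->
  exists delta, 0 < delta /\ forall h, Cmod h < delta ->
    Cmod (f (z + h) - f z - h * d)%C <= eps * Cmod h.
Proof.
intros He [_ H].
destruct (H z (fun P HP => HP) (mkposreal _ He)) as [delta Hd].
exists delta; split; [apply cond_pos|]; intros h Hh.
specialize (Hd (z + h)%C).
assert (E : (z + h - z)%C = h) by ring.
rewrite <- E at 2 3; apply Hd.
unfold ball; simpl; unfold AbsRing_ball, abs; simpl.
change (Cmod (z + h - z)%C < delta); now rewrite E.
Qed.

Lemma is_derive_C_unique (f : C -> C) (z d1 d2 : C) :
  is_derive (K := C_AbsRing) (V := C_NormedModule) f z d1 ->
  is_derive (K := C_AbsRing) (V := C_NormedModule) f z d2 -> d1 = d2.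
Proof.
intros H1 H2.
destruct (Ceq_dec (d1 - d2) (RtoC 0)) as [E|N].
{ replace d1 with (d1 - d2 + d2)%C by ring; rewrite E; ring. }
exfalso; assert (Hm : 0 < Cmod (d1 - d2)) by now apply Cmod_gt_0.
assert (He : 0 < Cmod (d1 - d2) / 4) by lra.
destruct (is_derive_C_elim f z d1 _ He H1) as (e1 & P1 & Q1).
destruct (is_derive_C_elim f z d2 _ He H2) as (e2 & P2 & Q2).
set (h := Rmin e1 e2 / 2).
assert (Hh : 0 < h) by (unfold h; pose proof (Rmin_glb_lt e1 e2 0 P1 P2); lra).
assert (Ch : Cmod h = h) by (rewrite Cmod_R, Rabs_right; lra).
pose proof (Rmin_l e1 e2); pose proof (Rmin_r e1 e2).
specialize (Q1 h ltac:(rewrite Ch; unfold h; lra)).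
specialize (Q2 h ltac:(rewrite Ch; unfold h; lra)).
assert (T : Cmod (h * (d1 - d2)) <= Cmod (f (z + h)%C - f z - h * d1) + Cmod (f (z + h)%C - f z - h * d2)).
{ replace (h * (d1 - d2))%C with (- (f (z + h)%C - f z - h * d1) + (f (z + h)%C - f z - h * d2))%C by ring.
  apply Rle_trans with (1 := Cmod_triangle _ _); rewrite Cmod_opp; lra. }
rewrite Cmod_mult, !Ch in *; nra.
Qed.

(** The limit of the derivatives is the derivative of the limit, by the uniform remainder. *)
Lemma w_derivative (nu : R) l c1 c (z D : C) : -1 < nu -> approximants nu l c1 c ->
  z <> RtoC 0 -> Clim (fun N => prodC (c1 N :: c N) z) D ->
  is_derive (K := C_AbsRing) (V := C_NormedModule) (w nu) z D.
Proof.
intros Hnu H Hz HD.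
assert (Hm : 0 < Cmod z) by now apply Cmod_gt_0.
destruct (squares_sum_bounded nu l c1 c Hnu H) as (S & N0 & HS & HN).
set (Z := Cmod z + 1).
apply is_derive_C_intro with ((Z * S ^ 2 + S) * exp (S * Z)) (Rmin 1 (Cmod z)).
{ apply Rmin_glb_lt; lra. }
intros h Hh.
assert (Hh1 : Cmod h < 1) by (apply Rlt_le_trans with (1 := Hh), Rmin_l).
assert (Hh2 : Cmod h < Cmod z) by (apply Rlt_le_trans with (1 := Hh), Rmin_r).
assert (Hzh : (z + h)%C <> RtoC 0).
{ intros E; replace h with (- z)%C in Hh2; [rewrite Cmod_opp in Hh2; lra|].
  replace h with (z + h - z)%C by ring; rewrite E; ring. }
destruct (w_limit nu l c1 c z Hnu H Hz) as (F & D' & -> & HF & _).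
destruct (w_limit nu l c1 c (z + h)%C Hnu H Hzh) as (F' & D'' & -> & HF' & _).
set (P := fun N => prodC (squares (l N))).
assert (L : Clim (fun N => (z + h) * P N (z + h) + - (z * P N z) + - (h * prodC (c1 N :: c N) z))%C
  ((z + h) * F' + - (z * F) + - (h * D))%C).
{ repeat apply Clim_plus; try apply Clim_opp; apply Clim_mult; auto using Clim_const. }
apply Clim_Cmod in L.
apply (lim_le_eventually _ _ _ L); exists N0; intros N HN0.
destruct (HN N HN0) as [HS' _].
assert (Pos : forall t, In t (squares (l N)) -> 0 <= t)
  by (intros t Ht; pose proof (approx_largest_l _ _ _ _ _ (H N) t Ht); lra).
assert (B : Cmod z + Cmod h <= Z) by (unfold Z; lra).
pose proof (prodC_lipschitz _ Z z h Pos B) as R1.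
pose proof (prodC_remainder _ Z z h Pos B) as R2.
pose proof (power_sum_nonneg 1 _ Pos) as Hs.
rewrite (prodC_derivative _ _ _ _ _ z (H N)).
replace ((z + h) * P N (z + h) + - (z * P N z)
    + - (h * (prodC (squares (l N)) z + z * dprodC (squares (l N)) z)))%C
  with (z * (P N (z + h) - P N z - h * dprodC (squares (l N)) z) + h * (P N (z + h) - P N z))%C
  by (unfold P; ring).
apply Rle_trans with (1 := Cmod_triangle _ _); rewrite !Cmod_mult; unfold P.
set (s := power_sum 1 (squares (l N))) in *.
assert (E : exp (s * Z) <= exp (S * Z)).
{ apply exp_le, Rmult_le_compat_r; [unfold Z; lra|exact HS']. }
pose proof (exp_pos (s * Z)); pose proof (Cmod_ge_0 h) as Hh0.
assert (E1 : s * exp (s * Z) <= S * exp (S * Z)) by (apply Rmult_le_compat; lra).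
assert (E2 : s ^ 2 * exp (s * Z) <= S ^ 2 * exp (S * Z)).
{ apply Rmult_le_compat; try lra; [apply pow_le; lra|apply pow_incr; lra]. }
apply Rle_trans with (Z * (Cmod h ^ 2 * (S ^ 2 * exp (S * Z)))
  + Cmod h * (Cmod h * (S * exp (S * Z)))); [|right; ring].
apply Rplus_le_compat.
- apply Rmult_le_compat; [lra|apply Cmod_ge_0|unfold Z; lra|].
  apply Rle_trans with (1 := R2), Rmult_le_compat_l; [apply pow_le; lra|exact E2].
- apply Rmult_le_compat_l; [lra|].
  apply Rle_trans with (1 := R1), Rmult_le_compat_l; [lra|exact E1].
Qed.

Lemma prodR_derivative (nu : R) (N : nat) (l : list R) (c1 : R) (c : list R) (x : R) :
  approximant nu N l c1 c ->
  prodR (c1 :: c) x = prodR (squares l) x + x * dprodR (squares l) x.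
Proof.
intros H; apply RtoC_inj.
rewrite RtoC_plus, RtoC_mult, <- dprodC_RtoC, <- !prodC_RtoC.
now apply prodC_derivative with (1 := H).
Qed.

(** For the approximants, [Re (z W' / W)] is at least [1 - log_slope], which is the value of
[r W'(r) / W(r)] at [r = |z|].  With [p = W / z], this value is at least
[prodR (c1 :: c) r], because [0 < p(r) <= 1]; the latter is bounded below
independently of the degree, so strict positivity passes to the limit. *)
Lemma starlike_of_largest (nu : R) l c1 c (r : R) : -1 < nu -> approximants nu l c1 c ->
  0 < r -> (exists N0, forall N, (N0 <= N)%nat -> c1 N <= / r) ->
  starlike_in_disc (w nu) r.
Proof.
intros Hnu H Hr [N1 HN1] z Hz Hzr.
assert (Hm : 0 < Cmod z) by now apply Cmod_gt_0.
destruct (squares_sum_bounded nu l c1 c Hnu H) as (S & N0 & HS & HN).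
destruct (w_limit nu l c1 c z Hnu H Hz) as (F & D & Ew & HF & HD).
set (m := Cmod z) in *; set (rho := m / r).
assert (Hrho : 0 < rho < 1).
{ unfold rho; split; [now apply Rdiv_lt_0_compat|].
  apply Rmult_lt_reg_r with r; [exact Hr|].
  replace (m / r * r) with m by (field; lra); lra. }
(* S bounds the sums of the c_i, so delta does not depend on the degree. *)
set (delta := exp (- (m / (1 - rho) * S))).
assert (Hdelta : 0 < delta) by apply exp_pos.
assert (HK : 0 < m / (1 - rho)) by (apply Rdiv_lt_0_compat; lra).
assert (Main : forall N, (N0 <= N)%nat -> (N1 <= N)%nat ->
  delta <= Cmod (prodC (squares (l N)) z) /\
  delta * Cmod (prodC (squares (l N)) z) ^ 2
    <= Re (prodC (c1 N :: c N) z * Cconj (prodC (squares (l N)) z))).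
{ intros N HN0 HN1'; specialize (HN1 N HN1'); destruct (HN N HN0) as [_ HS'].
  assert (Hc1 : c1 N * m <= rho).
  { unfold rho, Rdiv; rewrite Rmult_comm; apply Rmult_le_compat_l; lra. }
  assert (Hl : forall t, In t (squares (l N)) -> 0 <= t /\ t * m < 1).
  { intros t Ht; pose proof (approx_largest_l _ _ _ _ _ (H N) t Ht) as B.
    split; [lra|]; assert (t * m <= c1 N * m) by (apply Rmult_le_compat_r; lra); lra. }
  assert (Hd : delta <= prodR (c1 N :: c N) m).
  { apply Rle_trans with (exp (- (m / (1 - rho) * power_sum 1 (c1 N :: c N)))).
    - apply exp_le, Ropp_le_contravar, Rmult_le_compat_l; lra.
    - apply prodR_exp_lower; [lra|lra|]; intros t Ht.
      pose proof (approximant_positive nu l c1 c N t H Ht) as B.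
      split; [lra|]; assert (t * m <= c1 N * m) by (apply Rmult_le_compat_r; lra); lra. }
  rewrite (prodR_derivative _ _ _ _ _ m (H N)) in Hd.
  rewrite (log_slope_spec (squares (l N)) m) in Hd by apply Hl.
  pose proof (prodR_le_1 (squares (l N)) m ltac:(lra) Hl) as HP.
  pose proof (log_slope_nonneg (squares (l N)) m ltac:(lra) Hl) as HE.
  set (E := log_slope (squares (l N)) m) in *; set (Q := prodR (squares (l N)) m) in *.
  pose proof (prodC_lower_bound (squares (l N)) z Hl) as HL; fold m Q in HL.
  split; [nra|].
  rewrite (prodC_derivative _ _ _ _ _ z (H N)).
  pose proof (log_derivative_real_part (squares (l N)) z Hl) as HR; fold m E in HR.
  rewrite Cmult_plus_distr_r.
  replace (Re (prodC (squares (l N)) z * Cconj (prodC (squares (l N)) z)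
      + z * dprodC (squares (l N)) z * Cconj (prodC (squares (l N)) z)))
    with (Re (prodC (squares (l N)) z * Cconj (prodC (squares (l N)) z))
      + Re (z * dprodC (squares (l N)) z * Cconj (prodC (squares (l N)) z)))
    by reflexivity.
  rewrite Re_conj_self.
  set (p := Cmod (prodC (squares (l N)) z)) in *.
  assert (delta <= 1 - E) by nra.
  pose proof (pow2_ge_0 p); nra. }
assert (HFm : delta <= Cmod F).
{ assert (- Cmod F <= - delta); [|lra].
  apply (lim_le_eventually (fun N => - Cmod (prodC (squares (l N)) z))).
  - apply (is_lim_seq_opp _ (Cmod F)), Clim_Cmod, HF.
  - exists (N0 + N1)%nat; intros N HN'; apply Ropp_le_contravar, Main; lia. }
assert (HRe : delta * Cmod F ^ 2 <= Re (D * Cconj F)).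
{ assert (delta * Cmod F ^ 2 - Re (D * Cconj F) <= 0); [|lra].
  apply (lim_le_eventually (fun N => delta * Cmod (prodC (squares (l N)) z) ^ 2
    - Re (prodC (c1 N :: c N) z * Cconj (prodC (squares (l N)) z)))).
  - apply is_lim_seq_minus'.
    + apply is_lim_seq_mult'; [apply is_lim_seq_const|apply Clim_Cmod_sq, HF].
    + assert (HFc : Clim (fun N => Cconj (prodC (squares (l N)) z)) (Cconj F)).
      { destruct HF as [HF1 HF2]; split; simpl; [exact HF1|].
        apply (is_lim_seq_opp _ (Im F)), HF2. }
      apply (Clim_mult _ _ _ _ HD HFc).
  - exists (N0 + N1)%nat; intros N HN'.
    assert (M := proj2 (Main N ltac:(lia) ltac:(lia))); lra. }
assert (HF0 : F <> RtoC 0) by (intros E; rewrite E, Cmod_0 in HFm; lra).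
split.
- rewrite Ew; now apply Cmult_neq_0.
- exists D; split; [now apply w_derivative with l c1 c|].
  rewrite Ew.
  replace (z * D / (z * F))%C with (RtoC (/ Cmod F ^ 2) * (D * Cconj F))%C.
  + rewrite Re_scal; apply Rmult_lt_0_compat.
    * apply Rinv_0_lt_compat, pow_lt; lra.
    * apply Rlt_le_trans with (2 := HRe), Rmult_lt_0_compat; [exact Hdelta|apply pow_lt; lra].
  + assert (HFF : (F * Cconj F)%C = RtoC (Cmod F ^ 2)).
    { rewrite <- Re_conj_self; destruct F; apply injective_projections; simpl; ring. }
    assert (Hc : RtoC (Cmod F ^ 2) <> RtoC 0).
    { intros E; apply RtoC_inj in E; revert E; apply pow_nonzero; lra. }
    rewrite RtoC_inv by (apply pow_nonzero; lra).
    rewrite <- HFF in *; field; repeat split; auto.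
    intros E; apply Hc; rewrite E; ring.
Qed.

(** The points [1 / c1] have a cluster point, where the derivative of [w] vanishes because the
approximating derivatives are equi-Lipschitz. *)
Lemma not_starlike_of_largest (nu : R) l c1 c (kappa r : R) : -1 < nu ->
  approximants nu l c1 c -> 0 < kappa ->
  (exists N0, forall N, (N0 <= N)%nat -> kappa <= c1 N) ->
  starlike_in_disc (w nu) r -> r <= / kappa.
Proof.
intros Hnu H Hk [N1 HN1] Hs.
apply Rnot_lt_le; intros Hr.
destruct (squares_sum_bounded nu l c1 c Hnu H) as (S & N0 & HS & HN).
assert (Up : forall N, (N0 <= N)%nat -> c1 N <= S).
{ intros N HN0; destruct (HN N HN0) as [_ B]; rewrite power_sum_cons, pow_1 in B.
  assert (0 <= power_sum 1 (c N)); [|lra].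
  apply power_sum_nonneg; intros t Ht; pose proof (approx_largest _ _ _ _ _ (H N) t Ht); lra. }
set (x := fun n => / c1 (N0 + N1 + n)%nat).
assert (Hx : forall n, / S <= x n <= / kappa).
{ intros n; unfold x.
  specialize (Up (N0 + N1 + n)%nat ltac:(lia)); specialize (HN1 (N0 + N1 + n)%nat ltac:(lia)).
  split; apply Rinv_le_contravar; lra. }
destruct (Bolzano_Weierstrass x (fun y => / S <= y <= / kappa) (compact_P3 _ _) Hx) as [xi Hxi].
assert (HSi : 0 < / S) by now apply Rinv_0_lt_compat.
assert (Hki : 0 < / kappa) by now apply Rinv_0_lt_compat.
assert (Close : forall e, 0 < e -> forall N, exists p, (N <= p)%nat /\ Rabs (x p - xi) < e).
{ intros e He N; destruct (Hxi (fun y => Rabs (y - xi) < e) N) as (p & Hp & Hp').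
  - exists (mkposreal e He); intros y Hy; exact Hy.
  - now exists p. }
assert (Bxi : / S <= xi <= / kappa).
{ split; apply Rnot_lt_le; intros C.
  - destruct (Close (/ S - xi) ltac:(lra) O) as (p & _ & Hp).
    apply Rabs_def2 in Hp; pose proof (Hx p); lra.
  - destruct (Close (xi - / kappa) ltac:(lra) O) as (p & _ & Hp).
    apply Rabs_def2 in Hp; pose proof (Hx p); lra. }
assert (Hz : RtoC xi <> RtoC 0) by (intros E; apply RtoC_inj in E; lra).
destruct (w_limit nu l c1 c xi Hnu H Hz) as (F & D & Ew & HF & HD).
assert (HD0 : D = RtoC 0).
{ destruct (Ceq_dec D (RtoC 0)) as [E|N]; [exact E|exfalso].
  assert (Hm : 0 < Cmod D) by now apply Cmod_gt_0.
  destruct (eventually_ge _ _ (Cmod D / 2) (Clim_Cmod _ _ HD)) as [N2 HN2]; [lra|].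
  set (Z := / kappa + / kappa); set (K := S * exp (S * Z)).
  assert (HK : 0 < K) by (apply Rmult_lt_0_compat; [exact HS|apply exp_pos]).
  destruct (Close (Cmod D / 2 / K) ltac:(apply Rdiv_lt_0_compat; lra) N2) as (p & Hp1 & Hp2).
  set (M := (N0 + N1 + p)%nat) in *.
  specialize (HN2 M ltac:(unfold M; lia)).
  destruct (HN M ltac:(unfold M; lia)) as [_ HSM].
  set (cc := c1 M :: c M) in *.
  assert (Pos : forall t, In t cc -> 0 <= t)
    by (intros t Ht; pose proof (approximant_positive nu l c1 c M t H Ht); lra).
  set (h := RtoC (xi - x p)).
  assert (Hch : Cmod h = Rabs (x p - xi))
    by (unfold h; rewrite Cmod_R, <- Rabs_Ropp; f_equal; ring).
  assert (Hch' : Rabs (x p - xi) <= / kappa).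
  { pose proof (Hx p); apply Rabs_le; lra. }
  assert (B : Cmod (x p) + Cmod h <= Z).
  { rewrite Hch, Cmod_R, Rabs_right by (pose proof (Hx p); lra).
    pose proof (Hx p); unfold Z; lra. }
  pose proof (prodC_lipschitz cc Z (x p) h Pos B) as Lip.
  replace (RtoC (x p) + h)%C with (RtoC xi) in Lip
    by (unfold h; rewrite <- RtoC_plus; f_equal; ring).
  replace (prodC cc (x p)) with (RtoC 0) in Lip.
  2:{ rewrite prodC_RtoC; f_equal; unfold x; symmetry; apply prodR_root; [|now left].
      pose proof (approx_largest_pos _ _ _ _ _ (H M)); fold M; lra. }
  replace (prodC cc xi - RtoC 0)%C with (prodC cc xi) in Lip by ring.
  rewrite Hch in Lip.
  pose proof (power_sum_nonneg 1 cc Pos) as Hps.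
  assert (E1 : power_sum 1 cc * exp (power_sum 1 cc * Z) <= K).
  { apply Rmult_le_compat; [exact Hps|left; apply exp_pos|exact HSM|].
    apply exp_le, Rmult_le_compat_r; [unfold Z; lra|exact HSM]. }
  assert (E2 : Rabs (x p - xi) * K < Cmod D / 2).
  { apply Rmult_lt_reg_r with (/ K); [now apply Rinv_0_lt_compat|].
    replace (Rabs (x p - xi) * K * / K) with (Rabs (x p - xi)) by (field; lra); exact Hp2. }
  pose proof (Rabs_pos (x p - xi)).
  assert (Rabs (x p - xi) * (power_sum 1 cc * exp (power_sum 1 cc * Z))
    <= Rabs (x p - xi) * K) by (apply Rmult_le_compat_l; lra).
  lra. }
destruct (Hs xi Hz) as [_ (d & Hd & Hpos)].
{ rewrite Cmod_R, Rabs_right; lra. }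
assert (d = D).
{ apply (is_derive_C_unique (w nu) xi); [exact Hd|now apply w_derivative with l c1 c]. }
subst d; rewrite HD0 in Hpos.
replace (xi * RtoC 0 / w nu xi)%C with (RtoC 0) in Hpos by (unfold Cdiv; ring).
simpl in Hpos; lra.
Qed.

(** * Limits of the power sums *)

Definition rayleigh_scale (nu : R) : R := 16 * (nu + 1) ^ 2 * (nu + 2).

(** [rayleigh_sum] is the limit of the power sums of the [c_i]; [rayleigh_num] is its value in
units of [1 / rayleigh_scale], in which the bounds of the theorem take a simple form.  Both are
meant for orders 1 to 4. *)
Definition rayleigh_num (nu : R) (k : nat) : R :=
  match k with
  | 1%nat => 2
  | 2%nat => (nu ^ 2 + 22 * nu + 45) / ((nu + 3) * (nu + 4))
  | 3%nat => nu11 nu / ((nu + 3) ^ 2 * (nu + 4) * (nu + 5) * (nu + 6))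
  | _ => nu12 nu / ((nu + 3) ^ 2 * (nu + 4) ^ 2 * (nu + 5) * (nu + 6) * (nu + 7) * (nu + 8))
  end.

Definition rayleigh_sum (nu : R) (k : nat) : R := rayleigh_num nu k / rayleigh_scale nu ^ k.

(** The Taylor coefficients of [w nu z / z] up to sign. *)
Definition w_coef (nu : R) (k : nat) : R :=
  / (16 ^ k * INR (fact k) * pochhammer (nu + 1) k * pochhammer (nu + 1) (2 * k)).

Lemma is_lim_seq_pow (u : nat -> R) (l : R) (n : nat) :
  is_lim_seq u l -> is_lim_seq (fun N => u N ^ n) (l ^ n).
Proof.
intros H; induction n as [|n IH]; simpl; [apply is_lim_seq_const|].
now apply is_lim_seq_mult'.
Qed.

Ltac polynomial_limit tac :=
  repeat lazymatch goal with
  | |- is_lim_seq (fun _ => _ + _) _ => apply is_lim_seq_plus'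
  | |- is_lim_seq (fun _ => _ - _) _ => apply is_lim_seq_minus'
  | |- is_lim_seq (fun _ => _ * _) _ => apply is_lim_seq_mult'
  | |- is_lim_seq (fun _ => _ ^ _) _ => apply is_lim_seq_pow
  | |- is_lim_seq (fun _ => elem_sym _ _) _ => tac
  | |- is_lim_seq (fun _ => ?a) _ => apply (is_lim_seq_const a)
  end.

(** Only the first four coefficients of [g s * g (- s)] are computed, by expanding the finite
products; the general product formula for the Bessel functions is avoided. *)
Lemma squares_lim (nu : R) l c1 c (k : nat) : -1 < nu -> approximants nu l c1 c ->
  (1 <= k <= 4)%nat ->
  is_lim_seq (fun N => elem_sym k (squares (l N))) (w_coef nu k).
Proof.
intros Hnu H Hk.
assert (Lim : forall j, is_lim_seq (fun N => elem_sym j (l N)) (bessel_coef nu j))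
  by (intros j; now apply approximant_lim with c1 c).
set (b := bessel_coef nu) in *.
assert (K : k = 1%nat \/ k = 2%nat \/ k = 3%nat \/ k = 4%nat) by lia.
destruct K as [-> |[-> |[-> | ->]]].
- apply is_lim_seq_ext with (fun N => elem_sym 1 (l N) ^ 2 - 2 * elem_sym 2 (l N)).
  { intros N; symmetry; apply elem_sym_squares_1. }
  replace (w_coef nu 1) with (b 1%nat ^ 2 - 2 * b 2%nat).
  2:{ unfold w_coef, b; simpl; field; lra. }
  polynomial_limit ltac:(apply Lim).
- apply is_lim_seq_ext with (fun N => elem_sym 2 (l N) ^ 2
    - 2 * elem_sym 1 (l N) * elem_sym 3 (l N) + 2 * elem_sym 4 (l N)).
  { intros N; symmetry; apply elem_sym_squares_2. }
  replace (w_coef nu 2) with (b 2%nat ^ 2 - 2 * b 1%nat * b 3%nat + 2 * b 4%nat).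
  2:{ unfold w_coef, b; simpl; field; lra. }
  polynomial_limit ltac:(apply Lim).
- apply is_lim_seq_ext with (fun N => elem_sym 3 (l N) ^ 2
    - 2 * elem_sym 2 (l N) * elem_sym 4 (l N) + 2 * elem_sym 1 (l N) * elem_sym 5 (l N)
    - 2 * elem_sym 6 (l N)).
  { intros N; symmetry; apply elem_sym_squares_3. }
  replace (w_coef nu 3) with (b 3%nat ^ 2 - 2 * b 2%nat * b 4%nat
    + 2 * b 1%nat * b 5%nat - 2 * b 6%nat).
  2:{ unfold w_coef, b; simpl; field; lra. }
  polynomial_limit ltac:(apply Lim).
- apply is_lim_seq_ext with (fun N => elem_sym 4 (l N) ^ 2
    - 2 * elem_sym 3 (l N) * elem_sym 5 (l N) + 2 * elem_sym 2 (l N) * elem_sym 6 (l N)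
    - 2 * elem_sym 1 (l N) * elem_sym 7 (l N) + 2 * elem_sym 8 (l N)).
  { intros N; symmetry; apply elem_sym_squares_4. }
  replace (w_coef nu 4) with (b 4%nat ^ 2 - 2 * b 3%nat * b 5%nat
    + 2 * b 2%nat * b 6%nat - 2 * b 1%nat * b 7%nat + 2 * b 8%nat).
  2:{ unfold w_coef, b; simpl; field; lra. }
  polynomial_limit ltac:(apply Lim).
Qed.

(** Newton's identities, with elementary symmetric functions [(k + 1) * w_coef nu k]. *)
Lemma power_sum_lim (nu : R) l c1 c (k : nat) : -1 < nu -> approximants nu l c1 c ->
  (1 <= k <= 4)%nat ->
  is_lim_seq (fun N => power_sum k (c1 N :: c N)) (rayleigh_sum nu k).
Proof.
intros Hnu H Hk.
assert (Lim : forall j, (1 <= j <= 4)%nat ->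
  is_lim_seq (fun N => elem_sym j (c1 N :: c N)) ((INR j + 1) * w_coef nu j)).
{ intros j Hj.
  apply is_lim_seq_ext with (fun N => (INR j + 1) * elem_sym j (squares (l N))).
  - intros N; now rewrite (approx_derivative _ _ _ _ _ (H N)).
  - apply is_lim_seq_mult'; [apply is_lim_seq_const|now apply squares_lim with c1 c]. }
set (e := fun j => (INR j + 1) * w_coef nu j) in *.
assert (K : k = 1%nat \/ k = 2%nat \/ k = 3%nat \/ k = 4%nat) by lia.
destruct K as [-> |[-> |[-> | ->]]].
- apply is_lim_seq_ext with (fun N => elem_sym 1 (c1 N :: c N)).
  { intros N; symmetry; apply newton_1. }
  replace (rayleigh_sum nu 1) with (e 1%nat).
  2:{ unfold rayleigh_sum, rayleigh_num, rayleigh_scale, e, w_coef; simpl; field; lra. }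
  apply Lim; lia.
- apply is_lim_seq_ext with
    (fun N => elem_sym 1 (c1 N :: c N) ^ 2 - 2 * elem_sym 2 (c1 N :: c N)).
  { intros N; symmetry; apply newton_2. }
  replace (rayleigh_sum nu 2) with (e 1%nat ^ 2 - 2 * e 2%nat).
  2:{ unfold rayleigh_sum, rayleigh_num, rayleigh_scale, e, w_coef; simpl; field; lra. }
  polynomial_limit ltac:(apply Lim; lia).
- apply is_lim_seq_ext with
    (fun N => elem_sym 1 (c1 N :: c N) ^ 3
      - 3 * elem_sym 1 (c1 N :: c N) * elem_sym 2 (c1 N :: c N) + 3 * elem_sym 3 (c1 N :: c N)).
  { intros N; symmetry; apply newton_3. }
  replace (rayleigh_sum nu 3) with (e 1%nat ^ 3 - 3 * e 1%nat * e 2%nat + 3 * e 3%nat).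
  2:{ unfold rayleigh_sum, rayleigh_num, rayleigh_scale, nu11, e, w_coef; simpl; field; lra. }
  polynomial_limit ltac:(apply Lim; lia).
- apply is_lim_seq_ext with
    (fun N => elem_sym 1 (c1 N :: c N) ^ 4
      - 4 * elem_sym 1 (c1 N :: c N) ^ 2 * elem_sym 2 (c1 N :: c N)
      + 2 * elem_sym 2 (c1 N :: c N) ^ 2
      + 4 * elem_sym 1 (c1 N :: c N) * elem_sym 3 (c1 N :: c N) - 4 * elem_sym 4 (c1 N :: c N)).
  { intros N; symmetry; apply newton_4. }
  replace (rayleigh_sum nu 4) with (e 1%nat ^ 4 - 4 * e 1%nat ^ 2 * e 2%nat + 2 * e 2%nat ^ 2
      + 4 * e 1%nat * e 3%nat - 4 * e 4%nat).
  2:{ unfold rayleigh_sum, rayleigh_num, rayleigh_scale, nu12, e, w_coef; simpl; field; lra. }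
  polynomial_limit ltac:(apply Lim; lia).
Qed.

(** * The bounds *)

Ltac positive :=
  repeat first
    [ lra
    | apply Rplus_lt_0_compat
    | apply Rdiv_lt_0_compat
    | apply Rmult_lt_0_compat
    | apply pow_lt ].

Lemma nu11_pos (nu : R) : -1 < nu -> 0 < nu11 nu.
Proof.
intros H; set (m := nu + 1); assert (0 < m) by (unfold m; lra).
replace (nu11 nu) with (1920 + m * (3424 + m * (2008 + m * (450 + m * (31 + m)))))
  by (unfold nu11, m; ring).
positive.
Qed.

Lemma nu12_pos (nu : R) : -1 < nu -> 0 < nu12 nu.
Proof.
intros H; set (m := nu + 1); assert (0 < m) by (unfold m; lra).
replace (nu12 nu) with (483840 + m * (1173888 + m * (1091904 + m * (503936
  + m * (125140 + m * (16847 + m * (1218 + m * (52 + m)))))))) by (unfold nu12, m; ring).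
positive.
Qed.

Lemma quadratic_pos (nu : R) : -1 < nu -> 0 < nu ^ 2 + 22 * nu + 45.
Proof.
intros H; replace (nu ^ 2 + 22 * nu + 45) with ((nu + 1) ^ 2 + 20 * (nu + 1) + 24) by ring.
positive.
Qed.

Lemma rayleigh_scale_pos (nu : R) : -1 < nu -> 0 < rayleigh_scale nu.
Proof. intros H; unfold rayleigh_scale; positive. Qed.

Lemma rayleigh_num_pos (nu : R) (k : nat) : -1 < nu -> 0 < rayleigh_num nu k.
Proof.
intros H; pose proof (nu11_pos nu H); pose proof (nu12_pos nu H); pose proof (quadratic_pos nu H).
unfold rayleigh_num; destruct k as [|[|[|[|k]]]]; positive.
Qed.

(** This and the next four inequalities become evident in the variable [nu + 1]: the
numerator of the difference has nonnegative coefficients. *)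
Lemma rayleigh_num_2_lt (nu : R) : -1 < nu -> rayleigh_num nu 2 < rayleigh_num nu 1 ^ 2.
Proof.
intros H; apply Rlt_0_minus; unfold rayleigh_num.
replace (2 ^ 2 - (nu ^ 2 + 22 * nu + 45) / ((nu + 3) * (nu + 4)))
  with (3 * (nu + 1) ^ 2 / ((nu + 3) * (nu + 4))) by (field; lra).
positive.
Qed.

Lemma rayleigh_num_23 (nu : R) : -1 < nu -> rayleigh_num nu 3 ^ 2 < rayleigh_num nu 2 ^ 3.
Proof.
intros H; apply Rlt_0_minus; unfold rayleigh_num, nu11.
set (m := nu + 1); assert (0 < m) by (unfold m; lra).
match goal with |- 0 < ?e => replace e with
  (m ^ 4 * (106560 + m * (217632 + m * (162164 + m * (55480 + m * (8843 + m * (582 + 15 * m))))))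
   / ((nu + 3) ^ 4 * (nu + 4) ^ 3 * (nu + 5) ^ 2 * (nu + 6) ^ 2)) end.
2:{ unfold m; field; lra. }
positive.
Qed.

Lemma rayleigh_num_24 (nu : R) : -1 < nu ->
  rayleigh_num nu 3 ^ 2 < rayleigh_num nu 2 * rayleigh_num nu 4.
Proof.
intros H; apply Rlt_0_minus; unfold rayleigh_num, nu11, nu12.
set (m := nu + 1); assert (0 < m) by (unfold m; lra).
match goal with |- 0 < ?e => replace e with
  (m ^ 4 * (1491840 + m * (3508608 + m * (3137208 + m * (1395012 + m * (335552
     + m * (44860 + m * (3493 + m * (178 + 5 * m))))))))
   / ((nu + 3) ^ 4 * (nu + 4) ^ 3 * (nu + 5) ^ 2 * (nu + 6) ^ 2 * (nu + 7) * (nu + 8))) end.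
2:{ unfold m; field; lra. }
positive.
Qed.

Lemma rayleigh_num_13 (nu : R) : -1 < nu ->
  rayleigh_num nu 2 ^ 2 < rayleigh_num nu 1 * rayleigh_num nu 3.
Proof.
intros H; apply Rlt_0_minus; unfold rayleigh_num, nu11.
set (m := nu + 1); assert (0 < m) by (unfold m; lra).
match goal with |- 0 < ?e => replace e with
  (m ^ 2 * (720 + m * (924 + m * (258 + m * (19 + m))))
   / ((nu + 3) ^ 2 * (nu + 4) ^ 2 * (nu + 5) * (nu + 6))) end.
2:{ unfold m; field; lra. }
positive.
Qed.

Lemma rayleigh_num_2_lt_3 (nu : R) : -1 < nu -> rayleigh_num nu 2 < rayleigh_num nu 3.
Proof.
intros H; apply Rlt_0_minus; unfold rayleigh_num, nu11.
set (m := nu + 1); assert (0 < m) by (unfold m; lra).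
match goal with |- 0 < ?e => replace e with
  ((960 + m * (1712 + m * (944 + m * 168)))
   / ((nu + 3) ^ 2 * (nu + 4) * (nu + 5) * (nu + 6))) end.
2:{ unfold m; field; lra. }
positive.
Qed.

Lemma rayleigh_sum_pos (nu : R) (k : nat) : -1 < nu -> 0 < rayleigh_sum nu k.
Proof.
intros H; apply Rdiv_lt_0_compat; [now apply rayleigh_num_pos|].
now apply pow_lt, rayleigh_scale_pos.
Qed.

(** The sum of [t (t - x)^2]. *)
Lemma power_sum_tail (c : list R) (x : R) : (forall t, In t c -> 0 <= t) ->
  0 <= power_sum 3 c - 2 * x * power_sum 2 c + x ^ 2 * power_sum 1 c.
Proof.
induction c as [|t c IH]; intros H; [unfold power_sum; simpl; lra|].
rewrite !power_sum_cons.
assert (IH' := IH (fun u Hu => H u (or_intror Hu))).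
pose proof (H t (or_introl eq_refl)) as Ht.
pose proof (Rmult_le_pos _ _ Ht (pow2_ge_0 (t - x))). nra.
Qed.

(** The sum of [t (M - t) (t - x)^2]. *)
Lemma power_sum_gap (c : list R) (M x : R) : (forall t, In t c -> 0 <= t <= M) ->
  0 <= (M * power_sum 3 c - power_sum 4 c) - 2 * x * (M * power_sum 2 c - power_sum 3 c)
       + x ^ 2 * (M * power_sum 1 c - power_sum 2 c).
Proof.
induction c as [|t c IH]; intros H; [unfold power_sum; simpl; lra|].
rewrite !power_sum_cons.
assert (IH' := IH (fun u Hu => H u (or_intror Hu))).
destruct (H t (or_introl eq_refl)) as [Ht HtM].
assert (K : 0 <= t * (M - t) * (t - x) ^ 2).
{ apply Rmult_le_pos; [apply Rmult_le_pos; lra|apply pow2_ge_0]. }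
replace (M * (t ^ 3 + power_sum 3 c) - (t ^ 4 + power_sum 4 c)
    - 2 * x * (M * (t ^ 2 + power_sum 2 c) - (t ^ 3 + power_sum 3 c))
    + x ^ 2 * (M * (t ^ 1 + power_sum 1 c) - (t ^ 2 + power_sum 2 c)))
  with (t * (M - t) * (t - x) ^ 2
    + ((M * power_sum 3 c - power_sum 4 c) - 2 * x * (M * power_sum 2 c - power_sum 3 c)
       + x ^ 2 * (M * power_sum 1 c - power_sum 2 c))) by ring.
lra.
Qed.

(** The Cauchy-Schwarz inequality in discriminant form; replacing [d] by an upper bound [S]
avoids the case [d = 0]. *)
Lemma cauchy_from_quadratic (a b d S : R) : 0 < S -> d <= S ->
  (forall x, 0 <= a - 2 * x * b + x ^ 2 * d) -> b ^ 2 / S <= a.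
Proof.
intros HS Hd H; specialize (H (b / S)).
assert (E : (b / S) ^ 2 * d <= (b / S) ^ 2 * S)
  by (apply Rmult_le_compat_l; [apply pow2_ge_0|exact Hd]).
replace (2 * (b / S) * b) with (2 * (b ^ 2 / S)) in H by (field; lra).
replace ((b / S) ^ 2 * S) with (b ^ 2 / S) in E by (field; lra). lra.
Qed.

(** Cauchy-Schwarz on the entries other than [M] gives [(s_2 - M^2)^2 <= s_1 (s_3 - M^3)],
while [M^6 <= s_3^2] keeps [s_2 - M^2] away from 0. *)
Lemma largest_upper (M : R) (c : list R) : 0 < M -> (forall t, In t c -> 0 < t <= M) ->
  let s k := power_sum k (M :: c) in
  s 3%nat ^ 2 <= s 2%nat ^ 3 ->
  M ^ 3 <= s 3%nat - ((s 2%nat ^ 3 - s 3%nat ^ 2) / (3 * s 2%nat ^ 2)) ^ 2 / s 1%nat.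
Proof.
intros HM Hc s H23.
assert (Hc0 : forall t, In t c -> 0 <= t) by (intros t Ht; destruct (Hc t Ht); lra).
pose proof (power_sum_nonneg 1 c Hc0) as P1.
pose proof (power_sum_nonneg 2 c Hc0) as P2.
pose proof (power_sum_nonneg 3 c Hc0) as P3.
assert (E1 : s 1%nat = M + power_sum 1 c) by (unfold s; rewrite power_sum_cons; ring).
assert (E2 : s 2%nat = M ^ 2 + power_sum 2 c) by (unfold s; now rewrite power_sum_cons).
assert (E3 : s 3%nat = M ^ 3 + power_sum 3 c) by (unfold s; now rewrite power_sum_cons).
clearbody s; pose proof (pow_lt M 2 HM); pose proof (pow_lt M 3 HM).
assert (CS : power_sum 2 c ^ 2 / s 1%nat <= power_sum 3 c).
{ apply cauchy_from_quadratic with (power_sum 1 c); [lra|lra|].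
  intros x; now apply power_sum_tail. }
set (S1 := s 1%nat) in *; set (S2 := s 2%nat) in *; set (S3 := s 3%nat) in *.
assert (G : (S2 ^ 3 - S3 ^ 2) / (3 * S2 ^ 2) <= power_sum 2 c).
{ assert (H6 : M ^ 6 <= S3 ^ 2).
  { replace (M ^ 6) with ((M ^ 3) ^ 2) by ring; apply pow_incr; lra. }
  apply Rmult_le_reg_r with (3 * S2 ^ 2); [assert (0 < S2 ^ 2) by (apply pow_lt; lra); lra|].
  replace ((S2 ^ 3 - S3 ^ 2) / (3 * S2 ^ 2) * (3 * S2 ^ 2)) with (S2 ^ 3 - S3 ^ 2)
    by (field; lra).
  apply Rle_trans with (S2 ^ 3 - M ^ 6); [lra|].
  replace (M ^ 6) with ((M ^ 2) ^ 3) by ring.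
  replace (S2 ^ 3 - (M ^ 2) ^ 3) with ((S2 - M ^ 2) * (S2 ^ 2 + S2 * M ^ 2 + (M ^ 2) ^ 2)) by ring.
  replace (S2 - M ^ 2) with (power_sum 2 c) by lra.
  apply Rmult_le_compat_l; [exact P2|]; nra. }
assert (G0 : 0 <= (S2 ^ 3 - S3 ^ 2) / (3 * S2 ^ 2)).
{ apply Rmult_le_pos; [lra|left; apply Rinv_0_lt_compat].
  assert (0 < S2 ^ 2) by (apply pow_lt; lra); lra. }
set (g := (S2 ^ 3 - S3 ^ 2) / (3 * S2 ^ 2)) in *.
assert (g ^ 2 / S1 <= power_sum 2 c ^ 2 / S1).
{ apply Rmult_le_compat_r; [left; apply Rinv_0_lt_compat; lra|apply pow_incr; lra]. }
lra.
Qed.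

(** Cauchy-Schwarz with the weights [t (M - t)] gives
[(M s_2 - s_3)^2 <= s_1^2 (M s_3 - s_4)], while [s_4 <= M s_3] keeps [M s_2 - s_3] away
from 0. *)
Lemma largest_lower (M : R) (c : list R) : 0 < M -> (forall t, In t c -> 0 < t <= M) ->
  let s k := power_sum k (M :: c) in
  s 3%nat ^ 2 <= s 2%nat * s 4%nat ->
  (s 4%nat + ((s 2%nat * s 4%nat - s 3%nat ^ 2) / s 3%nat) ^ 2 / s 1%nat ^ 2) / s 3%nat <= M.
Proof.
intros HM Hc s H24.
assert (Hc1 : forall t, In t (M :: c) -> 0 <= t <= M).
{ intros t [<-|Ht]; [lra|destruct (Hc t Ht); lra]. }
assert (Hp : forall k, 0 < s k).
{ intros k; unfold s; rewrite power_sum_cons.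
  assert (0 <= power_sum k c)
    by (apply power_sum_nonneg; intros t Ht; destruct (Hc t Ht); lra).
  pose proof (pow_lt M k HM); lra. }
assert (HM1 : M <= s 1%nat).
{ unfold s; rewrite power_sum_cons, pow_1.
  assert (0 <= power_sum 1 c)
    by (apply power_sum_nonneg; intros t Ht; destruct (Hc t Ht); lra). lra. }
assert (Q : forall x, 0 <= (M * s 3%nat - s 4%nat) - 2 * x * (M * s 2%nat - s 3%nat)
       + x ^ 2 * (M * s 1%nat - s 2%nat)) by (intros x; now apply power_sum_gap).
clearbody s.
pose proof (Hp 1%nat); pose proof (Hp 2%nat); pose proof (Hp 3%nat); pose proof (Hp 4%nat).
set (S1 := s 1%nat) in *; set (S2 := s 2%nat) in *; set (S3 := s 3%nat) in *;
  set (S4 := s 4%nat) in *.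
assert (CS : (M * S2 - S3) ^ 2 / S1 ^ 2 <= M * S3 - S4).
{ apply cauchy_from_quadratic with (M * S1 - S2); [now apply pow_lt|nra|exact Q]. }
assert (A3 : S4 <= M * S3) by (specialize (Q 0); lra).
assert (G : (S2 * S4 - S3 ^ 2) / S3 <= M * S2 - S3).
{ apply Rmult_le_reg_r with S3; [assumption|].
  replace ((S2 * S4 - S3 ^ 2) / S3 * S3) with (S2 * S4 - S3 ^ 2) by (field; lra). nra. }
assert (G0 : 0 <= (S2 * S4 - S3 ^ 2) / S3).
{ apply Rmult_le_pos; [lra|left; now apply Rinv_0_lt_compat]. }
set (g := (S2 * S4 - S3 ^ 2) / S3) in *.
assert (g ^ 2 / S1 ^ 2 <= (M * S2 - S3) ^ 2 / S1 ^ 2).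
{ apply Rmult_le_compat_r; [left; apply Rinv_0_lt_compat, pow_lt; assumption|apply pow_incr; lra]. }
apply Rmult_le_reg_r with S3; [assumption|].
replace ((S4 + g ^ 2 / S1 ^ 2) / S3 * S3) with (S4 + g ^ 2 / S1 ^ 2) by (field; lra). lra.
Qed.

Lemma rayleigh_sum_scaled (nu : R) (k : nat) : -1 < nu ->
  rayleigh_num nu k = rayleigh_sum nu k * rayleigh_scale nu ^ k.
Proof.
intros H; unfold rayleigh_sum; field; apply pow_nonzero.
pose proof (rayleigh_scale_pos nu H); lra.
Qed.

Lemma rayleigh_sum_ineqs (nu : R) : -1 < nu ->
  rayleigh_sum nu 2 < rayleigh_sum nu 1 ^ 2 /\
  rayleigh_sum nu 3 ^ 2 < rayleigh_sum nu 2 ^ 3 /\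
  rayleigh_sum nu 3 ^ 2 < rayleigh_sum nu 2 * rayleigh_sum nu 4.
Proof.
intros H; pose proof (rayleigh_scale_pos nu H) as HU.
pose proof (rayleigh_num_2_lt nu H) as A1.
pose proof (rayleigh_num_23 nu H) as A2.
pose proof (rayleigh_num_24 nu H) as A3.
rewrite (rayleigh_sum_scaled nu 2), (rayleigh_sum_scaled nu 1) in A1 by exact H.
rewrite (rayleigh_sum_scaled nu 2), (rayleigh_sum_scaled nu 3) in A2 by exact H.
rewrite (rayleigh_sum_scaled nu 2), (rayleigh_sum_scaled nu 3), (rayleigh_sum_scaled nu 4) in A3
  by exact H.
set (U := rayleigh_scale nu) in *.
repeat split.
- apply Rmult_lt_reg_r with (U ^ 2); [now apply pow_lt|].
  replace (rayleigh_sum nu 1 ^ 2 * U ^ 2) with ((rayleigh_sum nu 1 * U ^ 1) ^ 2) by ring; lra.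
- apply Rmult_lt_reg_r with (U ^ 6); [now apply pow_lt|].
  replace (rayleigh_sum nu 3 ^ 2 * U ^ 6) with ((rayleigh_sum nu 3 * U ^ 3) ^ 2) by ring.
  replace (rayleigh_sum nu 2 ^ 3 * U ^ 6) with ((rayleigh_sum nu 2 * U ^ 2) ^ 3) by ring; lra.
- apply Rmult_lt_reg_r with (U ^ 6); [now apply pow_lt|].
  replace (rayleigh_sum nu 3 ^ 2 * U ^ 6) with ((rayleigh_sum nu 3 * U ^ 3) ^ 2) by ring.
  replace (rayleigh_sum nu 2 * rayleigh_sum nu 4 * U ^ 6)
    with (rayleigh_sum nu 2 * U ^ 2 * (rayleigh_sum nu 4 * U ^ 4)) by ring; exact A3.
Qed.

Lemma pow_lt_reg (x y : R) (n : nat) : 0 <= y -> x ^ n < y ^ n -> x < y.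
Proof.
intros Hy H; apply Rnot_le_lt; intros C.
pose proof (pow_incr y x n (conj Hy C)); lra.
Qed.

Lemma cbrt_pow (x : R) : 0 < x -> 0 < cbrt x /\ cbrt x ^ 3 = x.
Proof.
intros Hx; unfold cbrt; split; [apply exp_pos|].
rewrite <- Rpower_pow by apply exp_pos; rewrite Rpower_mult.
replace (1 / 3 * INR 3) with 1 by (simpl; field); now apply Rpower_1.
Qed.

Lemma radius_lower (nu : R) : -1 < nu ->
  exists r, 0 < r /\ / rayleigh_sum nu 3 < r ^ 3 /\ Rbar_le r (radius_starlike (w nu)).
Proof.
intros Hnu; destruct (approximants_exist nu Hnu) as (l & c1 & c & H).
destruct (rayleigh_sum_ineqs nu Hnu) as (_ & H23 & _).
pose proof (rayleigh_sum_pos nu 1 Hnu) as P1.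
pose proof (rayleigh_sum_pos nu 2 Hnu) as P2.
pose proof (rayleigh_sum_pos nu 3 Hnu) as P3.
pose proof (power_sum_lim nu l c1 c 1 Hnu H ltac:(lia)) as L1.
pose proof (power_sum_lim nu l c1 c 2 Hnu H ltac:(lia)) as L2.
pose proof (power_sum_lim nu l c1 c 3 Hnu H ltac:(lia)) as L3.
set (s := fun k N => power_sum k (c1 N :: c N)).
set (s1 := rayleigh_sum nu 1) in *; set (s2 := rayleigh_sum nu 2) in *;
  set (s3 := rayleigh_sum nu 3) in *.
set (eta := ((s2 ^ 3 - s3 ^ 2) / (3 * s2 ^ 2)) ^ 2 / s1).
assert (Heta : 0 < eta).
{ unfold eta; apply Rdiv_lt_0_compat; [|exact P1]; apply pow_lt, Rdiv_lt_0_compat; [lra|].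
  assert (0 < s2 ^ 2) by now apply pow_lt. lra. }
assert (Lim : is_lim_seq (fun N => s 3%nat N
    - ((s 2%nat N ^ 3 - s 3%nat N ^ 2) / (3 * s 2%nat N ^ 2)) ^ 2 / s 1%nat N) (s3 - eta)).
{ apply is_lim_seq_minus'; [exact L3|].
  apply is_lim_seq_div'; [|exact L1|lra].
  apply is_lim_seq_pow, is_lim_seq_div'.
  - apply is_lim_seq_minus'; now apply is_lim_seq_pow.
  - apply is_lim_seq_mult'; [apply is_lim_seq_const|now apply is_lim_seq_pow].
  - assert (0 < s2 ^ 2) by now apply pow_lt. lra. }
(* The maximum with s3 / 2 only serves to keep q positive. *)
set (q := Rmax (s3 - eta / 2) (s3 / 2)).
assert (Hq : s3 - eta < q /\ 0 < q < s3).
{ unfold q; pose proof (Rmax_l (s3 - eta / 2) (s3 / 2)); pose proof (Rmax_r (s3 - eta / 2) (s3 / 2)).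
  split; [lra|]; split; [lra|]; apply Rmax_lub_lt; lra. }
destruct (eventually_le _ _ q Lim) as [N1 HN1]; [tauto|].
assert (L23 : is_lim_seq (fun N => s 2%nat N ^ 3 - s 3%nat N ^ 2) (s2 ^ 3 - s3 ^ 2))
  by (apply is_lim_seq_minus'; now apply is_lim_seq_pow).
destruct (eventually_ge _ _ 0 L23) as [N2 HN2]; [lra|].
destruct (cbrt_pow q) as [Hc Hc3]; [tauto|].
exists (/ cbrt q); split; [now apply Rinv_0_lt_compat|]; split.
- rewrite pow_inv, Hc3; apply Rinv_lt_contravar; [apply Rmult_lt_0_compat|]; tauto.
- apply Lub_Rbar_correct; split; [now apply Rinv_0_lt_compat|].
  apply starlike_of_largest with l c1 c; auto; [now apply Rinv_0_lt_compat|].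
  exists (N1 + N2)%nat; intros N HN; rewrite Rinv_inv.
  apply Rnot_lt_le; intros C.
  specialize (HN1 N ltac:(lia)); specialize (HN2 N ltac:(lia)); simpl in HN1, HN2.
  pose proof (largest_upper (c1 N) (c N) (approx_largest_pos _ _ _ _ _ (H N))
    (approx_largest _ _ _ _ _ (H N))) as B; simpl in B.
  specialize (B ltac:(unfold s in HN2; simpl in HN2; lra)).
  assert (cbrt q ^ 3 < c1 N ^ 3).
  { simpl; rewrite !Rmult_1_r; apply Rmult_gt_0_lt_compat; nra. }
  unfold s in HN1; simpl in HN1, B, H0, Hc3; lra.
Qed.

Lemma radius_upper (nu : R) : -1 < nu ->
  exists r, r < rayleigh_sum nu 3 / rayleigh_sum nu 4 /\
    Rbar_le (radius_starlike (w nu)) r.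
Proof.
intros Hnu; destruct (approximants_exist nu Hnu) as (l & c1 & c & H).
destruct (rayleigh_sum_ineqs nu Hnu) as (_ & _ & H24).
pose proof (rayleigh_sum_pos nu 1 Hnu) as P1.
pose proof (rayleigh_sum_pos nu 2 Hnu) as P2.
pose proof (rayleigh_sum_pos nu 3 Hnu) as P3.
pose proof (rayleigh_sum_pos nu 4 Hnu) as P4.
pose proof (power_sum_lim nu l c1 c 1 Hnu H ltac:(lia)) as L1.
pose proof (power_sum_lim nu l c1 c 2 Hnu H ltac:(lia)) as L2.
pose proof (power_sum_lim nu l c1 c 3 Hnu H ltac:(lia)) as L3.
pose proof (power_sum_lim nu l c1 c 4 Hnu H ltac:(lia)) as L4.
set (s := fun k N => power_sum k (c1 N :: c N)).
set (s1 := rayleigh_sum nu 1) in *; set (s2 := rayleigh_sum nu 2) in *;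
  set (s3 := rayleigh_sum nu 3) in *; set (s4 := rayleigh_sum nu 4) in *.
set (eta := ((s2 * s4 - s3 ^ 2) / s3) ^ 2 / s1 ^ 2).
assert (Heta : 0 < eta).
{ unfold eta; apply Rdiv_lt_0_compat; [|now apply pow_lt].
  apply pow_lt, Rdiv_lt_0_compat; lra. }
assert (Lim : is_lim_seq (fun N => (s 4%nat N
    + ((s 2%nat N * s 4%nat N - s 3%nat N ^ 2) / s 3%nat N) ^ 2 / s 1%nat N ^ 2) / s 3%nat N)
    ((s4 + eta) / s3)).
{ apply is_lim_seq_div'; [|exact L3|lra].
  apply is_lim_seq_plus'; [exact L4|].
  apply is_lim_seq_div'; [|now apply is_lim_seq_pow|apply pow_nonzero; lra].
  apply is_lim_seq_pow, is_lim_seq_div'; [|exact L3|lra].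
  apply is_lim_seq_minus'; [now apply is_lim_seq_mult'|now apply is_lim_seq_pow]. }
set (kappa := (s4 + eta / 2) / s3).
assert (Hk : kappa < (s4 + eta) / s3).
{ apply Rmult_lt_compat_r; [now apply Rinv_0_lt_compat|lra]. }
assert (Hk0 : 0 < kappa) by (apply Rdiv_lt_0_compat; lra).
destruct (eventually_ge _ _ kappa Lim Hk) as [N1 HN1].
assert (L24 : is_lim_seq (fun N => s 2%nat N * s 4%nat N - s 3%nat N ^ 2) (s2 * s4 - s3 ^ 2))
  by (apply is_lim_seq_minus'; [now apply is_lim_seq_mult'|now apply is_lim_seq_pow]).
destruct (eventually_ge _ _ 0 L24) as [N2 HN2]; [lra|].
exists (/ kappa); split.
- replace (s3 / s4) with (/ (s4 / s3)) by (field; lra).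
  apply Rinv_lt_contravar.
  + apply Rmult_lt_0_compat; [now apply Rdiv_lt_0_compat|exact Hk0].
  + apply Rmult_lt_compat_r; [now apply Rinv_0_lt_compat|lra].
- apply Lub_Rbar_correct; intros r [_ Hr].
  apply (not_starlike_of_largest nu l c1 c kappa r Hnu H Hk0); [|exact Hr].
  exists (N1 + N2)%nat; intros N HN.
  specialize (HN1 N ltac:(lia)); specialize (HN2 N ltac:(lia)).
  apply Rle_trans with (1 := HN1).
  apply (largest_lower (c1 N) (c N) (approx_largest_pos _ _ _ _ _ (H N))
    (approx_largest _ _ _ _ _ (H N))).
  cbv beta in HN2; unfold s in HN2; lra.
Qed.

Theorem theorem11 :
  forall nu : R, -1 < nu ->
  Rbar_lt (radius_starlike (w nu)) (16 * (nu + 1) ^ 2 * (nu + 2)) /\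
  (Rbar_lt (8 * (nu + 1) ^ 2 * (nu + 2)) (radius_starlike (w nu)) /\
   Rbar_lt (radius_starlike (w nu))
     (32 * (nu + 1) * pochhammer (nu + 1) 4 / (nu ^ 2 + 22 * nu + 45))) /\
  (Rbar_lt
     (16 * (nu + 1) ^ 2 * (nu + 2)
      * sqrt ((nu + 3) * (nu + 4) / (nu ^ 2 + 22 * nu + 45)))
     (radius_starlike (w nu)) /\
   Rbar_lt (radius_starlike (w nu))
     (16 * (nu + 1) * pochhammer (nu + 1) 3 * pochhammer (nu + 5) 2
      * (nu ^ 2 + 22 * nu + 45) / nu11 nu)) /\
  (Rbar_lt
     (16 * (nu + 1) ^ 2 * (nu + 2)
      * cbrt ((nu + 3) * pochhammer (nu + 3) 4 / nu11 nu))
     (radius_starlike (w nu)) /\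
   Rbar_lt (radius_starlike (w nu))
     (16 * (nu + 1) ^ 2 * (nu + 2) * (nu + 4) * (nu + 7) * (nu + 8) * nu11 nu
      / nu12 nu)).
Proof.
intros nu Hnu.
pose proof (nu11_pos nu Hnu) as H11; pose proof (nu12_pos nu Hnu) as H12.
pose proof (quadratic_pos nu Hnu) as HQ; pose proof (rayleigh_scale_pos nu Hnu) as HU.
pose proof (rayleigh_num_pos nu 2 Hnu) as T2.
pose proof (rayleigh_num_pos nu 3 Hnu) as T3.
pose proof (rayleigh_num_pos nu 4 Hnu) as T4.
destruct (radius_lower nu Hnu) as (a & Ha & Ha3 & HaR).
destruct (radius_upper nu Hnu) as (b & Hb & HbR).
(* The sixth power clears both the square root and the cube root in the lower bounds. *)
assert (Low : forall x, 0 < x -> x ^ 6 * rayleigh_sum nu 3 ^ 2 <= 1 ->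
  Rbar_lt x (radius_starlike (w nu))).
{ intros x Hx H; apply Rbar_lt_le_trans with a; [|exact HaR].
  pose proof (rayleigh_sum_pos nu 3 Hnu) as P.
  apply pow_lt_reg with 6%nat; [lra|].
  apply Rle_lt_trans with ((/ rayleigh_sum nu 3) ^ 2).
  - apply Rmult_le_reg_r with (rayleigh_sum nu 3 ^ 2); [now apply pow_lt|].
    rewrite <- Rpow_mult_distr, Rinv_l by lra; lra.
  - replace (a ^ 6) with ((a ^ 3) ^ 2) by ring.
    assert (0 < / rayleigh_sum nu 3) by now apply Rinv_0_lt_compat.
    simpl; rewrite !Rmult_1_r; simpl in Ha3; rewrite Rmult_1_r in Ha3.
    apply Rmult_gt_0_lt_compat; lra. }
assert (Up : forall x, rayleigh_scale nu * (rayleigh_num nu 3 / rayleigh_num nu 4) <= x ->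
  Rbar_lt (radius_starlike (w nu)) x).
{ intros x Hx; apply Rbar_le_lt_trans with (1 := HbR); simpl.
  apply Rlt_le_trans with (1 := Hb), Rle_trans with (2 := Hx); right.
  unfold rayleigh_sum; field; repeat split; lra. }
destruct (rayleigh_sum_ineqs nu Hnu) as (I12 & I23 & _).
pose proof (rayleigh_num_2_lt_3 nu Hnu) as J23.
pose proof (rayleigh_num_13 nu Hnu) as J13.
pose proof (rayleigh_num_24 nu Hnu) as J24.
assert (Q34 : rayleigh_num nu 3 / rayleigh_num nu 4 <= rayleigh_num nu 2 / rayleigh_num nu 3).
{ apply Rmult_le_reg_r with (rayleigh_num nu 4 * rayleigh_num nu 3); [positive|].
  field_simplify; lra. }
assert (Q23 : rayleigh_num nu 2 / rayleigh_num nu 3 <= rayleigh_num nu 1 / rayleigh_num nu 2).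
{ apply Rmult_le_reg_r with (rayleigh_num nu 3 * rayleigh_num nu 2); [positive|].
  field_simplify; lra. }
assert (Q2 : rayleigh_num nu 2 / rayleigh_num nu 3 <= 1).
{ apply Rmult_le_reg_r with (rayleigh_num nu 3); [positive|]. field_simplify; lra. }
pose proof (rayleigh_sum_pos nu 1 Hnu) as P1.
pose proof (rayleigh_sum_pos nu 2 Hnu) as P2.
pose proof (rayleigh_sum_pos nu 3 Hnu) as P3.
repeat split.
- apply Up; fold (rayleigh_scale nu); nra.
- apply Low; [positive|].
  replace (8 * (nu + 1) ^ 2 * (nu + 2)) with (/ rayleigh_sum nu 1)
    by (unfold rayleigh_sum, rayleigh_num, rayleigh_scale; field; lra).
  apply Rle_trans with ((/ rayleigh_sum nu 1) ^ 6 * (rayleigh_sum nu 1 ^ 2) ^ 3);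
    [|right; field; lra].
  apply Rmult_le_compat_l; [apply pow_le; left; now apply Rinv_0_lt_compat|].
  apply Rle_trans with (rayleigh_sum nu 2 ^ 3); [lra|apply pow_incr; lra].
- apply Up; apply Rle_trans with (rayleigh_scale nu * (rayleigh_num nu 1 / rayleigh_num nu 2)).
  + apply Rmult_le_compat_l; lra.
  + right; unfold rayleigh_num, rayleigh_scale; simpl; field; lra.
- set (y := (nu + 3) * (nu + 4) / (nu ^ 2 + 22 * nu + 45)).
  assert (Hy : 0 < y) by (unfold y; positive).
  apply Low; [apply Rmult_lt_0_compat; [positive|now apply sqrt_lt_R0]|].
  fold (rayleigh_scale nu).
  replace ((rayleigh_scale nu * sqrt y) ^ 6) with ((rayleigh_scale nu ^ 2 * (sqrt y) ^ 2) ^ 3) by ring.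
  rewrite pow2_sqrt by lra.
  replace (rayleigh_scale nu ^ 2 * y) with (/ rayleigh_sum nu 2)
    by (unfold rayleigh_sum, rayleigh_num, y; field; lra).
  apply Rle_trans with ((/ rayleigh_sum nu 2) ^ 3 * rayleigh_sum nu 2 ^ 3);
    [|right; field; lra].
  apply Rmult_le_compat_l; [apply pow_le; left; now apply Rinv_0_lt_compat|lra].
- apply Up; apply Rle_trans with (rayleigh_scale nu * (rayleigh_num nu 2 / rayleigh_num nu 3)).
  + apply Rmult_le_compat_l; lra.
  + right; unfold rayleigh_num, rayleigh_scale; simpl; field; lra.
- set (y := (nu + 3) * pochhammer (nu + 3) 4 / nu11 nu).
  assert (Hy : 0 < y) by (unfold y; simpl; positive).
  destruct (cbrt_pow y Hy) as [Hc Hc3].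
  apply Low; [apply Rmult_lt_0_compat; [positive|exact Hc]|].
  fold (rayleigh_scale nu).
  replace ((rayleigh_scale nu * cbrt y) ^ 6) with ((rayleigh_scale nu ^ 3 * cbrt y ^ 3) ^ 2) by ring.
  rewrite Hc3.
  replace (rayleigh_scale nu ^ 3 * y) with (/ rayleigh_sum nu 3)
    by (unfold rayleigh_sum, rayleigh_num, y; simpl; field; lra).
  right; field; lra.
- apply Up; right; unfold rayleigh_num, rayleigh_scale; field; lra.
Qed.
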